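(* Let $a,b$ be two lines in the plane (possibly parallel), and let $K\subset\mathbb{R}^2$ be a bounded open set (not necessarily connected) with piecewise smooth boundary, lying in a sector formed by $a$ and $b$ (or between $a$ and $b$ if they are parallel), such that $\partial_aK:=\partial K\cap a$ and $\partial_bK:=\partial K\cap b$ are non-empty. Let $\partial_0K:=\partial K\setminus(\partial_aK\cup\partial_bK)$ be decomposed (up to finitely many points) into two non-intersecting sets $\partial_{0,D}K$ and $\partial_{0,N}K$, each a finite union of open segments (arcs) of $\partial K$, one of which may be empty. Let $T_a,T_b$ be the reflections of the plane with respect to $a$ and $b$. Put $$\Omega_1:=\mathrm{Int}\bigl(\overline{K\cup T_a(K)}\bigr),\qquad \Omega_2:=\mathrm{Int}\bigl(\overline{K\cup T_b(K)}\bigr),$$ and $$\partial_D\Omega_1:=\partial_{0,D}K\cup T_a(\partial_{0,D}K)\cup T_a(\partial_bK),\qquad \partial_N\Omega_1:=\partial_{0,N}K\cup T_a(\partial_{0,N}K)\cup\partial_bK,$$ $$\partial_D\Omega_2:=\partial_{0,D}K\cup T_b(\partial_{0,D}K)\cup\partial_aK,\qquad \partial_N\Omega_2:=\partial_{0,N}K\cup T_b(\partial_{0,N}K)\cup T_b(\partial_aK).$$ Then, for any such choice of $a$, $b$, $K$, $\partial_{0,D}K$, $\partial_{0,N}K$, $$\sigma_{DN}(\Omega_1)=\sigma_{DN}(\Omega_2)$$ with account of multiplicities.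
   Context: For a bounded open planar set $\Omega$ with piecewise smooth boundary decomposed (up to finitely many points) into disjoint parts $\partial_D\Omega$ and $\partial_N\Omega$, $\sigma_{DN}(\Omega)$ denotes the spectrum, i.e. the collection of eigenvalues $\lambda$ counted with multiplicities, of the mixed Dirichlet-Neumann problem $$-\Delta u=\lambda u \text{ in }\Omega,\qquad u|_{\partial_D\Omega}=0,\qquad \partial u/\partial n|_{\partial_N\Omega}=0,$$ where $\partial/\partial n$ is the normal derivative on the boundary. $\mathrm{Int}$ denotes the interior of a set. Boundary decompositions are understood up to finitely many points (e.g. end points of boundary arcs). A sector formed by two intersecting lines is one of the four regions into which they divide the plane. *)

(* Defs.v *)
From HB Require Import structures.
From mathcomp Require Import all_boot all_order all_algebra.
From mathcomp Require Import all_classical all_reals all_analysis.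

Set Implicit Arguments.
Unset Strict Implicit.
Unset Printing Implicit Defensive.

Import Order.TTheory GRing.Theory Num.Theory.
Import numFieldNormedType.Exports.

Local Open Scope classical_set_scope.
Local Open Scope ring_scope.

Section Plane.
Context {R : realType}.

Definition dot (x y : R * R) : R := x.1 * y.1 + x.2 * y.2.

(* The line [set x | dot (normal l) x = offset l]. *)
Record line := Line {
  normal : R * R;
  offset : R;
  normal_neq0 : normal != 0 }.

Definition side (l : line) (x : R * R) : R := dot (normal l) x - offset l.

Definition points (l : line) : set (R * R) := [set x | side l x = 0].

Definition reflection (l : line) (x : R * R) : R * R :=
  x - (2 * side l x / dot (normal l) (normal l)) *: normal l.

Definition parallel (a b : line) : Prop :=
  (normal a).1 * (normal b).2 - (normal a).2 * (normal b).1 = 0.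

(* The four sectors of two intersecting lines, indexed by s and t. *)
Definition sector (a b : line) (s t : bool) : set (R * R) :=
  [set x | 0 < (-1) ^+ s * side a x /\ 0 < (-1) ^+ t * side b x].

(* The open strip bounded by two parallel lines; it has empty interior when
   the two lines coincide. *)
Definition between (a b : line) : set (R * R) :=
  [set x | exists y z t, [/\ points a y, points b z, 0 < t < 1 &
                             x = (1 - t) *: y + t *: z]].

Definition lies_in_sector (a b : line) (K : set (R * R)) : Prop :=
  (parallel a b /\ K `<=` between a b) \/
  (~ parallel a b /\ exists s t, K `<=` sector a b s t).

Definition boundary (A : set (R * R)) : set (R * R) :=
  closure A `\` interior A.

(* The relative interior of A in G.  For a part A of a curve G, this removes
   from A its end points and its isolated contact points. *)
Definition relint (G A : set (R * R)) : set (R * R) :=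
  [set p | A p /\ \forall q \near p, G q -> A q].

End Plane.

Arguments line : clear implicits.

(* f is of class C^k on the open set A.  Having continuous derivatives in all
   directions is the same as having continuous partial derivatives. *)
Fixpoint Ck_on {R : realType} {V W : normedModType R} (k : nat)
    (A : set V) (f : V -> W) : Prop :=
  (forall p, A p -> {for p, continuous f}) /\
  (if k is k'.+1 then
     forall v, (forall p, A p -> derivable f p v) /\ Ck_on k' A ('D_v f)
   else True).

Definition smooth_on {R : realType} {V W : normedModType R}
    (A : set V) (f : V -> W) : Prop :=
  forall k, Ck_on k A f.

Section Boundary.
Context {R : realType}.

(* Near p, the set Om is [set x | phi x < 0] for a smooth phi whose gradient
   at p is a positive multiple of the unit vector n.  Such an n exists exactly
   when p is a smooth point of the boundary with Om on one side only. *)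
Definition outer_normal (Om : set (R * R)) (p n : R * R) : Prop :=
  exists (U : set (R * R)) (phi : R * R -> R) (c : R),
    [/\ open_nbhs p U, smooth_on U phi,
        (forall x, U x -> (Om x <-> phi x < 0)),
        phi p = 0 &
        [/\ dot n n = 1, 0 < c & forall v, 'D_v phi p = c * dot n v]].

(* The boundary is a finite union of smooth regular closed arcs and all but
   finitely many of its points are smooth; the latter excludes slits and
   infinitely oscillating contacts between arcs. *)
Definition piecewise_smooth_boundary (Om : set (R * R)) : Prop :=
  (exists (m : nat) (g : 'I_m -> R -> R * R),
     (forall i, smooth_on setT (g i) /\
                forall t, t \in `[0, 1] -> 'D_1 (g i) t != 0) /\
     boundary Om = \bigcup_(i in setT) (g i @` `[0, 1])) /\
  finite_set [set p | boundary Om p /\ ~ exists n, outer_normal Om p n].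

Definition finite_union_of_open_arcs (A : set (R * R)) : Prop :=
  exists (m : nat) (g : 'I_m -> R -> R * R),
    (forall i, {within `[0, 1], continuous (g i)} /\
               {in `]0, 1[ &, injective (g i)}) /\
    A = \bigcup_(i in setT) (g i @` `]0, 1[).

End Boundary.

Section MixedProblem.
Context {R : realType}.

Definition e1 : R * R := (1, 0).
Definition e2 : R * R := (0, 1).

Definition laplacian (u : R * R -> R) (x : R * R) : R :=
  'D_e1 ('D_e1 u) x + 'D_e2 ('D_e2 u) x.

(* Squared norm in the Sobolev space H^1(Om). *)
Definition energy (Om : set (R * R)) (u : R * R -> R) : \bar R :=
  (\int[(@lebesgue_measure R \x @lebesgue_measure R)]_(x in Om)
    ((u x) ^+ 2 + ('D_e1 u x) ^+ 2 + ('D_e2 u x) ^+ 2)%:E)%E.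

(* w is a C^2 extension of u from Om to a neighbourhood of p. *)
Definition C2_extension (Om : set (R * R)) (p : R * R)
    (u w : R * R -> R) : Prop :=
  exists U, [/\ open_nbhs p U, Ck_on 2 U w &
                forall x, U x -> Om x -> w x = u x].

(* Solutions of the mixed problem
     - laplacian u = lam u in Om,  u = 0 on D,  du/dn = 0 on N.
   The boundary conditions hold in the classical sense at the smooth boundary
   points, up to which u is C^2.  At the finitely many remaining points
   (corners, junctions between D and N) only finite energy is required; this
   is what rules out the non-variational singular solutions there.  D and N
   are meant to be relatively open in the boundary.  Values of u outside Om
   are irrelevant. *)
Definition mixed_solution (Om D N : set (R * R)) (lam : R)
    (u : R * R -> R) : Prop :=
  [/\ Ck_on 2 Om u,
      (forall x, Om x -> - laplacian u x = lam * u x),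
      (energy Om u < +oo)%E,
      (forall p n, outer_normal Om p n -> D p ->
         exists w, C2_extension Om p u w /\ w p = 0) &
      (forall p n, outer_normal Om p n -> N p ->
         exists w, C2_extension Om p u w /\ 'D_n w p = 0)].

Definition lin_indep_on (Om : set (R * R)) (m : nat)
    (f : 'I_m -> R * R -> R) : Prop :=
  forall c : 'I_m -> R,
    (forall x, Om x -> \sum_(i < m) c i * f i x = 0) -> forall i, c i = 0.

(* The spectrum with multiplicities, as the function mapping lam to the
   dimension (possibly +oo) of the space of solutions; lam is an eigenvalue
   when this is nonzero. *)
Definition sigma_DN (Om D N : set (R * R)) : R -> \bar R := fun lam =>
  ereal_sup [set (m%:R)%:E | m in [set m : nat |
    exists f : 'I_m -> R * R -> R,
      (forall i, mixed_solution Om D N lam (f i)) /\ lin_indep_on Om f]].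

End MixedProblem.

(* Main.v *)
From HB Require Import structures.
Require Import Defs.
From mathcomp Require Import all_boot all_order all_algebra.
From mathcomp Require Import all_classical all_reals all_analysis.
From mathcomp Require Import measurable_realfun ring lra.
Import Order.TTheory GRing.Theory Num.Theory.
Import numFieldNormedType.Exports.
Local Open Scope classical_set_scope.
Local Open Scope ring_scope.
Set Implicit Arguments.
Unset Strict Implicit.
Unset Printing Implicit Defensive.

(* Transplantation. A solution [u] on the domain doubled across [a] is the same as the pair
   [f = u], [g = u o Ta] of its branches on [K]: smoothness across [a] means that [f - g]
   satisfies the Dirichlet and [f + g] the Neumann condition on the side [a], while the mixed
   conditions say that [f] is Neumann and [g] Dirichlet on the side [b].  These conditions are
   exchanged by [(f, g) |-> (f + g, f - g)], so [f + g] and [f - g] are the branches of a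
   solution on the domain doubled across [b]; the map is injective, hence the multiplicities
   agree.  The C^2 regularity of the unfolded function across the axis comes from matching the
   Cauchy data, the second normal derivative being recovered from the equation. *)

(** Three points shape the details. First, the exchanged pair [f + g], [f - g] puts the Neumann
    condition for the side [a] on [K] itself and the Dirichlet condition on its mirror image,
    opposite to [D2] and [N2]. The second domain is therefore reflected in [b] beforehand; after
    this the two problems differ only by swapping [a] and [b], so a single inequality of
    multiplicities, used twice, gives equality. Second, the doubled domain is the interior of a
    closure. It consists of [K], its mirror image and the open part of the axis bordering [K] only
    if [K] is the interior of its closure. This is extracted from the smoothness of all but finitely
    many boundary points, and a connectedness argument shows that [K] fills a half-disc at the axis
    points concerned. Third, the boundary conditions are classical and existential: some C^2
    extension has the right value or normal derivative. They can be computed with because value and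
    first derivatives of an extension at a boundary point are determined by the function inside. At
    the exceptional points only the energy is controlled, and it is transported because reflections
    preserve area and lines are null sets. *)

(** * Functions of class C^k *)

Section CkOn.
Context {R : realType} {V W : normedModType R}.
Implicit Types (A B : set V) (f g : V -> W) (p v : V).

Lemma Ck_onS k A B f : A `<=` B -> Ck_on k B f -> Ck_on k A f.
Proof.
move=> AB; elim: k f => [|k IH] f /= [cf df]; split => //.
- by move=> p /AB; exact: cf.
- by move=> p /AB; exact: cf.
- by move=> v; have [d1 d2] := df v; split; [move=> p /AB; exact: d1|exact: IH].
Qed.

(** Derivatives are total functions, so every clause of [Ck_on] is a condition at single points.
    This reduces regularity on a set to germs, which [near_eq_Ck_on] can then replace. *)
Lemma Ck_on_pointwise k A f :
  (forall p, A p -> Ck_on k [set p] f) -> Ck_on k A f.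
Proof.
elim: k f => [|k IH] f /= cf.
  by split=> // p Ap; have [h _] := cf _ Ap; exact: h.
split=> [p Ap|v]; first by have [h _] := cf _ Ap; exact: h.
split=> [p Ap|].
  by have [_ /(_ v)[h _]] := cf _ Ap; exact: h.
by apply: IH => p Ap; have [_ /(_ v)[_]] := cf _ Ap.
Qed.

Lemma Ck_onW k A f : Ck_on k.+1 A f -> Ck_on k A f.
Proof.
elim: k f => [|k IH] f; first by case.
move=> [cf df]; split => // v; have [d1 d2] := df v; split=> //.
exact: IH.
Qed.

Lemma Ck_on_cont k A f p : Ck_on k A f -> A p -> {for p, continuous f}.
Proof. by case: k => [|k] [cf _]; exact: cf. Qed.

Lemma Ck_on_derivable k A f p v : Ck_on k.+1 A f -> A p -> derivable f p v.
Proof. by move=> [_ /(_ v)[df _]]; exact: df. Qed.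

Lemma Ck_on_derive k A f v : Ck_on k.+1 A f -> Ck_on k A ('D_v f).
Proof. by move=> [_ /(_ v)[]]. Qed.

Lemma near_eq_derive_near f g p v :
  (\forall x \near p, f x = g x) -> \forall x \near p, 'D_v f x = 'D_v g x.
Proof.
move=> fg; near=> x; apply: near_eq_derive; near: x; exact: near_join fg.
Unshelve. all: by end_near. Qed.

Lemma near_eq_Ck_on k p f g :
  (\forall x \near p, f x = g x) -> Ck_on k [set p] f -> Ck_on k [set p] g.
Proof.
elim: k f g => [|k IH] f g fg /= [cf df].
  split=> // _ ->; rewrite /prop_for /continuous_at -(nbhs_singleton fg).
  by apply: cvg_trans (cf _ erefl); exact: near_eq_cvg.
split=> [_ ->|v].
  rewrite /prop_for /continuous_at -(nbhs_singleton fg).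
  by apply: cvg_trans (cf _ erefl); exact: near_eq_cvg.
have [d1 d2] := df v; split=> [_ ->|].
  by apply: (near_eq_derivable fg); exact: d1.
by apply: IH d2; exact: near_eq_derive_near.
Qed.

Lemma eq_Ck_on k A f g : open A -> {in A, f =1 g} ->
  Ck_on k A f -> Ck_on k A g.
Proof.
move=> oA fg cf; apply: Ck_on_pointwise => p Ap.
apply: (@near_eq_Ck_on _ _ f); last by apply: Ck_onS cf => _ ->.
by near=> x; apply/fg/mem_set; near: x; exact: open_nbhs_nbhs.
Unshelve. all: by end_near. Qed.

Lemma Ck_on_nbhs k p f :
  (exists U, open_nbhs p U /\ Ck_on k U f) -> Ck_on k [set p] f.
Proof. by move=> [U [[_ Up] cf]]; apply: Ck_onS cf => _ ->. Qed.

Lemma Ck_onD k A f g : open A ->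
  Ck_on k A f -> Ck_on k A g -> Ck_on k A (fun x => f x + g x).
Proof.
move=> oA; elim: k f g => [|k IH] f g.
  by move=> [cf _] [cg _]; split=> // p Ap; apply: cvgD; [exact: cf|exact: cg].
move=> Cf Cg; split=> [p Ap|v].
  by apply: cvgD; [apply: Ck_on_cont Cf Ap|apply: Ck_on_cont Cg Ap].
have Df p : A p -> derivable f p v by move=> Ap; exact: Ck_on_derivable Cf Ap.
have Dg p : A p -> derivable g p v by move=> Ap; exact: Ck_on_derivable Cg Ap.
split=> [p Ap|]; first by apply: derivableD; [exact: Df|exact: Dg].
apply: (@eq_Ck_on _ _ (fun x => 'D_v f x + 'D_v g x)) => //.
  by move=> x /set_mem Ax; rewrite deriveD //; [exact: Df|exact: Dg].
by apply: IH; exact: Ck_on_derive.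
Qed.

Lemma Ck_onZ k A f (c : R) : open A ->
  Ck_on k A f -> Ck_on k A (fun x => c *: f x).
Proof.
move=> oA; elim: k f => [|k IH] f.
  by move=> [cf _]; split=> // p Ap; apply: cvgZr; exact: cf.
move=> Cf; split=> [p Ap|v].
  by apply: cvgZr; apply: Ck_on_cont Cf Ap.
have Df p : A p -> derivable f p v by move=> Ap; exact: Ck_on_derivable Cf Ap.
split=> [p Ap|]; first by apply: derivableZ; exact: Df.
apply: (@eq_Ck_on _ _ (fun x => c *: 'D_v f x)) => //.
  by move=> x /set_mem Ax; rewrite deriveZ //; exact: Df.
by apply: IH; exact: Ck_on_derive.
Qed.

Lemma Ck_onB k A f g : open A ->
  Ck_on k A f -> Ck_on k A g -> Ck_on k A (fun x => f x - g x).
Proof.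
move=> oA Cf Cg; apply: (@eq_Ck_on _ _ (fun x => f x + (-1) *: g x)) => //.
  by move=> x _; rewrite scaleN1r.
by apply: Ck_onD => //; exact: Ck_onZ.
Qed.

Section Affine.
Variables (T L : V -> V).
Hypothesis TL : forall h v x, T (h *: v + x) = h *: L v + T x.

(** By [TL] the two difference quotients are the same function of [h], so this is not an instance of
    a chain rule but an equality of limits. *)
Lemma derivable_comp_affine f x v :
  derivable (f \o T) x v <-> derivable f (T x) (L v).
Proof.
rewrite /derivable; set g1 := fun h => _; set g2 := fun h => _.
suff -> : g1 = g2 by [].
by apply/funext => h; rewrite /g1 /g2 /= TL.
Qed.

Lemma derive_comp_affine f v x : 'D_v (f \o T) x = 'D_(L v) f (T x).
Proof.
rewrite /derive; set g1 := fun h => _; set g2 := fun h => _.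
suff -> : g1 = g2 by [].
by apply/funext => h; rewrite /g1 /g2 /= TL.
Qed.

Lemma Ck_on_comp_affine k A f : continuous T ->
  Ck_on k A f -> Ck_on k (T @^-1` A) (f \o T).
Proof.
move=> cT; elim: k f => [|k IH] f.
  move=> [cf _]; split=> // p Ap.
  by apply: (@continuous_comp _ _ _ T f p); [exact: cT|exact: cf Ap].
move=> Cf; split=> [p Ap|v].
  by apply: (@continuous_comp _ _ _ T f p); [exact: cT|exact: (Ck_on_cont Cf Ap)].
split=> [p Ap|]; first by apply/derivable_comp_affine; exact: Ck_on_derivable Cf Ap.
have -> : 'D_v (f \o T) = 'D_(L v) f \o T.
  by apply/funext => x; exact: derive_comp_affine.
by apply: IH; exact: Ck_on_derive.
Qed.

End Affine.

(** For nonzero [c] the quotient in direction [c *: v] at [h] is [c] times the quotient in direction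
    [v] at [c * h], and [c * h] stays in the punctured neighbourhoods of 0. *)
Lemma is_derive_dirZ f p v (c : R) : derivable f p v ->
  is_derive p (c *: v) f (c *: 'D_v f p).
Proof.
have [->|c0] := eqVneq c 0; first by rewrite !scale0r => _; exact: is_derive0.
move=> df.
suff H : (fun h => h^-1 *: ((f \o shift p) (h *: (c *: v)) - f p)) @ 0^' -->
    c *: 'D_v f p.
  by split; [apply/cvg_ex; eexists; exact: H|exact: cvg_lim].
have c0cvg : (fun h => c * h) @ 0^' `=>` 0^'.
  move=> S; rewrite /= /dnbhs /within /= => HS.
  suff : \forall x \near (0:R), c * x != 0 -> S (c * x).
    by apply: filterS => x H x0; apply: H; rewrite mulf_neq0.
  have : (fun x => c * x) @ (0:R) --> (0 : R).
    by rewrite -[X in _ --> X](mulr0 c); apply: cvgM; [exact: cvg_cst|exact: cvg_id].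
  by move=> /(_ _ HS).
have -> : (fun h => h^-1 *: ((f \o shift p) (h *: (c *: v)) - f p)) =
   (fun h => c *: ((c * h)^-1 *: ((f \o shift p) ((c * h) *: v) - f p))).
  apply/funext => h /=; rewrite invfM !scalerA mulrA mulfV// mul1r.
  by rewrite (mulrC h).
apply: cvgZr; exact: (cvg_comp _ _ c0cvg df).
Qed.

End CkOn.

(** * Mean value theorem along lines and linearity in the direction *)

Section RealValued.
Context {R : realType} {V : normedModType R}.
Implicit Types (A : set V) (f g : V -> R) (p v : V).

Lemma is_derive_along f p v (t : R) : derivable f (p + t *: v) v ->
  is_derive t 1 (fun s => f (p + s *: v)) ('D_v f (p + t *: v)).
Proof.
set x := p + t *: v => df.
have E : (fun h => h^-1 *: (((fun s => f (p + s *: v)) \o shift t) (h *: (1:R)) - f (p + t *: v))) =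
    (fun h => h^-1 *: ((f \o shift x) (h *: v) - f x)).
  apply/funext => h /=; rewrite /x; congr (_ *: (f _ - _)).
  by rewrite [h *: 1]mulr1 scalerDl addrCA.
split; first by rewrite /derivable E.
by rewrite /derive E.
Qed.

(** The sign of [h] is free because limits at 0 are two-sided; the intermediate point is then
    located only by its absolute value. *)
Lemma MVT_along f p v (h : R) :
  (forall t, `|t| <= `|h| -> derivable f (p + t *: v) v) ->
  exists2 t, `|t| <= `|h| & f (p + h *: v) - f p = h * 'D_v f (p + t *: v).
Proof.
move=> df.
have H a b : a <= b -> (forall t, a <= t <= b -> `|t| <= `|h|) ->
    exists2 t, `|t| <= `|h| &
      f (p + b *: v) - f (p + a *: v) = (b - a) * 'D_v f (p + t *: v).
  move=> ab abh.
  have [||t tab E] := @MVT_segment R (fun s => f (p + s *: v))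
      (fun t => 'D_v f (p + t *: v)) a b ab.
  - move=> t; rewrite in_itv /= => /andP[t0 th]; apply: is_derive_along; apply: df.
    by apply: abh; rewrite !ltW.
  - apply: derivable_within_continuous => t; rewrite in_itv /= => th.
    by have [] := is_derive_along (df _ (abh _ th)).
  - by exists t; [apply: abh; move: tab; rewrite in_itv|rewrite E mulrC].
have [h0|h0] := leP 0 h.
  have [t /andP[t0 th]|t th E] := H 0 h h0; first by rewrite !ger0_norm.
  by exists t => //; move: E; rewrite scale0r addr0 subr0.
have [t /andP[t0 th]|t th E] := H h 0 (ltW h0).
  by rewrite (ltr0_norm h0) ler0_norm// lerN2.
exists t => //; move: E; rewrite scale0r addr0 sub0r mulNr => E.
by rewrite -opprB E opprK.
Qed.

Lemma near_along p v (P : set V) : (\forall x \near p, P x) ->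
  exists2 e, 0 < e & forall s, `|s| <= e -> P (p + s *: v).
Proof.
move=> Pp.
have : (fun s : R => p + s *: v) @ (0:R) --> p.
  rewrite -[X in _ --> X]addr0 -[X in _ --> _ + X](scale0r v).
  apply: cvgD; first exact: cvg_cst.
  by apply: cvgZl; exact: cvg_id.
move=> /(_ _ Pp) /nbhs_ballP[e /= e0 He].
exists (e / 2); first by rewrite divr_gt0.
move=> s se; apply: He; rewrite /ball /= sub0r normrN.
by rewrite (le_lt_trans se)// ltr_pdivrMr// ltr_pMr// ltr1n.
Qed.

Lemma near_along2 p u v (P : set V) : (\forall x \near p, P x) ->
  exists2 e, 0 < e & forall s t, `|s| <= e -> `|t| <= e ->
    P (p + s *: u + t *: v).
Proof.
move=> Pp.
have : (fun z : R * R => p + z.1 *: u + z.2 *: v) @ ((0, 0):R * R) --> p.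
  rewrite -[X in _ --> X]addr0 -[X in _ --> _ + X](scale0r v).
  rewrite -[X in _ --> X + _]addr0 -[X in _ --> _ + X + _](scale0r u).
  apply: cvgD; first (apply: cvgD; first exact: cvg_cst).
    by apply: cvgZl; exact: cvg_fst.
  by apply: cvgZl; exact: cvg_snd.
move=> /(_ _ Pp) /nbhs_ballP[e /= e0 He].
exists (e / 2); first by rewrite divr_gt0.
have e2 : e / 2 < e by rewrite ltr_pdivrMr// ltr_pMr// ltr1n.
move=> s t se te; apply: (He (s, t)); split; rewrite /ball /= sub0r normrN.
  exact: le_lt_trans e2.
exact: le_lt_trans e2.
Qed.

(** [Ck_on] speaks of directional derivatives only, so linearity in the direction has to be earned.
    The increment is taken first along [u], then along [v]; by the mean value theorem the second
    piece is ['D_v f] at a nearby point, which tends to ['D_v f p] by continuity. *)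
Lemma derive_dirD A f p u v : open A -> A p -> Ck_on 1 A f ->
  'D_(u + v) f p = 'D_u f p + 'D_v f p.
Proof.
move=> oA Ap Cf.
have cDv : {for p, continuous ('D_v f)}.
  by apply: (Ck_on_cont (k := 0)) Ap; exact: Ck_on_derive.
have du : derivable f p u := Ck_on_derivable Cf Ap.
apply: cvg_lim => //.
have E : (fun h : R => h^-1 *: ((f \o shift p) (h *: (u + v)) - f p)) =
  (fun h => (h^-1 *: ((f \o shift p) (h *: u) - f p)) +
    h^-1 *: (f (p + h *: u + h *: v) - f (p + h *: u))).
  apply/funext => h /=; rewrite -scalerDr; congr (_ *: _).
  rewrite (addrC (h *: (u + v))) scalerDr addrA (addrC p (h *: u)).
  by rewrite [RHS]addrC addrA subrK.
rewrite E; apply: cvgD; first exact: du.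
apply/cvgrPdist_le => /= e e0.
have [d d0 Hd] := @near_along2 p u v (fun q => A q /\ `|'D_v f p - 'D_v f q| <= e) (filterI
  (open_nbhs_nbhs (conj oA Ap)) ((cvgrPdist_le _ _).1 cDv _ e0)).
near=> h.
have h0 : h != 0 by near: h; exact: nbhs_dnbhs_neq.
have hd : `|h| <= d.
  near: h; apply: dnbhs0_le => //.
suff [t th ->] : exists2 t, `|t| <= `|h| &
    h^-1 *: (f (p + h *: u + h *: v) - f (p + h *: u)) = 'D_v f (p + h *: u + t *: v).
  by have [] := Hd h t hd (le_trans th hd).
have [t th ->] := @MVT_along f (p + h *: u) v h (fun t th =>
  Ck_on_derivable Cf (Hd h t hd (le_trans th hd)).1).
by exists t => //; rewrite [_ *: _]mulrA mulVf// mul1r.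
Unshelve. all: by end_near. Qed.

End RealValued.

(** * Symmetry of mixed second derivatives *)

Section Schwarz.
Context {R : realType} {V : normedModType R}.
Implicit Types (A : set V) (f g : V -> R) (p v : V).

(** The mean value theorem is applied twice: along [u] to the increment [G] of [f] in direction [v],
    then along [v] to ['D_u f]. *)
Lemma second_difference A f p u v (h : R) : Ck_on 2 A f ->
  (forall s t, `|s| <= `|h| -> `|t| <= `|h| -> A (p + s *: u + t *: v)) ->
  exists s t, [/\ `|s| <= `|h|, `|t| <= `|h| &
    f (p + h *: u + h *: v) - f (p + h *: u) - (f (p + h *: v) - f p) =
    h * (h * 'D_v ('D_u f) (p + s *: u + t *: v))].
Proof.
move=> Cf hA.
pose T x := x + h *: v.
have TE k w x : T (k *: w + x) = k *: w + T x by rewrite /T addrA.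
pose G x := f (x + h *: v) - f x.
have hA0 s : `|s| <= `|h| -> A (p + s *: u).
  by move=> sh; have := hA s 0 sh; rewrite normr0 scale0r addr0; exact.
have dG s : `|s| <= `|h| -> is_derive (p + s *: u) u G
    ('D_u f (p + s *: u + h *: v) - 'D_u f (p + s *: u)).
  move=> sh.
  have d1 : derivable f (p + s *: u) u := Ck_on_derivable Cf (hA0 _ sh).
  have d2 : derivable f (p + s *: u + h *: v) u by exact: Ck_on_derivable Cf (hA _ _ sh _).
  have d3 : derivable (f \o T) (p + s *: u) u.
    exact/(derivable_comp_affine (L := id) TE).
  have := is_deriveB (derivableP d3) (derivableP d1).
  by rewrite (derive_comp_affine (L := id) TE).
have [|s sh E] := @MVT_along _ _ G p u h.
  by move=> t /dG[].
have [t|t th E2] := @MVT_along _ _ ('D_u f) (p + s *: u) v h.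
  by move=> th; apply: (Ck_on_derivable (Ck_on_derive _ Cf)); exact: hA.
exists s, t; split=> //.
by move: E; rewrite /G => ->; case: (dG _ sh) => _ ->; rewrite E2.
Qed.

Local Opaque derive.

(** The second difference is symmetric in [u] and [v] ([swap]), so the two mixed derivatives agree
    at two points close to [p]; continuity brings both points to [p]. *)
Lemma derive_schwarz A f p u v : open A -> A p -> Ck_on 2 A f ->
  'D_u ('D_v f) p = 'D_v ('D_u f) p.
Proof.
move=> oA Ap Cf; have swap (a b c d : R) : a - b - (c - d) = a - c - (b - d) by ring.
have near2 (a b c e : R) : `|a - c| <= e / 2 -> `|b - c| <= e / 2 -> `|a - b| <= e.
  by rewrite !ler_norml => /andP[? ?] /andP[? ?]; apply/andP; split; lra.
apply/eqP; rewrite -subr_eq0 -normr_le0; apply/ler_addgt0Pl => e e0; rewrite addr0.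
have e2 : 0 < e / 2 by rewrite divr_gt0.
have c1 : {for p, continuous ('D_u ('D_v f))}.
  by apply: (Ck_on_cont (k := 0)) Ap; do 2 apply: Ck_on_derive.
have c2 : {for p, continuous ('D_v ('D_u f))}.
  by apply: (Ck_on_cont (k := 0)) Ap; do 2 apply: Ck_on_derive.
have [h h0 Hh] := @near_along2 _ _ p u v _ (filterI (open_nbhs_nbhs (conj oA Ap))
  (filterI ((cvgrPdist_le _ _).1 c1 _ e2) ((cvgrPdist_le _ _).1 c2 _ e2))).
have hN : `|h| = h by rewrite ger0_norm// ltW.
have [|s [t [sh th E]]] := @second_difference A f p u v h Cf.
  by move=> s t; rewrite hN => sh th; have [] := Hh _ _ sh th.
have [|s' [t' [sh' th' E']]] := @second_difference A f p v u h Cf.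
  move=> s' t'; rewrite hN => sh' th'; have [] := Hh _ _ th' sh'.
  by rewrite addrAC.
rewrite !hN in sh th sh' th'.
have EE : 'D_v ('D_u f) (p + s *: u + t *: v) = 'D_u ('D_v f) (p + t' *: u + s' *: v).
  rewrite (addrAC p (t' *: u)).
  apply: (mulfI (lt0r_neq0 h0)); apply: (mulfI (lt0r_neq0 h0)).
  by rewrite (addrAC p (h *: v)) swap in E'; exact: etrans (esym E) E'.
have [_ [_ H1]] := Hh _ _ sh th.
have [_ [H2 _]] := Hh _ _ th' sh'.
rewrite -EE in H2.
exact: near2 H2 H1.
Qed.

End Schwarz.

(** * Extension by zero across the zero set of a continuous function *)

Section FlatExtension.
Context {R : realType} {V : normedModType R}.
Variable s : V -> R.
Hypothesis cs : continuous s.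
Implicit Types (A : set V) (f g : V -> R) (p v : V).

Definition zero_ext f x : R := if 0 < s x then f x else 0.

Fixpoint flat_on k A f : Prop :=
  (forall p, A p -> s p = 0 -> f p = 0) /\
  if k is k'.+1 then forall v, flat_on k' A ('D_v f) else True.

Lemma near_zero_ext f p : s p != 0 ->
  (0 < s p /\ \forall x \near p, f x = zero_ext f x) \/
  (s p < 0 /\ \forall x \near p, 0 = zero_ext f x).
Proof.
move=> sp; have [sp0|sp0|sp0] := ltrgt0P (s p); last by rewrite sp0 eqxx in sp.
  left; split=> //.
  have H : \forall x \near p, 0 < s x by apply: (cvgr_gt (s p)) => //; exact: cs.
  by apply: filterS H => x sx; rewrite /zero_ext sx.
right; split=> //.
have H : \forall x \near p, s x < 0 by apply: (cvgr_lt (s p)) => //; exact: cs.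
by apply: filterS H => x sx; rewrite /zero_ext ltNge ltW.
Qed.

Lemma norm_zero_ext f x : `|zero_ext f x| <= `|f x|.
Proof. by rewrite /zero_ext; case: ifP => // _; rewrite normr0. Qed.

Lemma zero_ext_cont f p : (s p = 0 -> f p = 0) ->
  {for p, continuous f} -> {for p, continuous (zero_ext f)}.
Proof.
move=> f0 cf; have [sp|/near_zero_ext H] := eqVneq (s p) 0; last first.
  have [[sp E]|[sp E]] := H f; rewrite /prop_for /continuous_at -(nbhs_singleton E).
    by apply: cvg_trans cf; exact: near_eq_cvg.
  have : (fun _ : V => 0 : R) @ p --> (0 : R) by exact: cvg_cst.
  by apply: cvg_trans; exact: near_eq_cvg.
rewrite /prop_for /continuous_at {2}/zero_ext sp ltxx.
move: cf; rewrite /prop_for /continuous_at (f0 sp) => /cvgr0Pnorm_le cf.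
apply/cvgr0Pnorm_le => e e0; near=> x; apply: le_trans (norm_zero_ext _ _) _.
by near: x; exact: cf.
Unshelve. all: by end_near. Qed.

(** Where [s] vanishes, the difference quotient of [zero_ext f] is bounded by that of [f], which
    tends to 0. Elsewhere [zero_ext f] is locally [f] or 0. *)
Lemma is_derive_zero_ext f p v : (s p = 0 -> f p = 0 /\ 'D_v f p = 0) ->
  derivable f p v -> is_derive p v (zero_ext f) (zero_ext ('D_v f) p).
Proof.
move=> f0 df; have [sp|/near_zero_ext H] := eqVneq (s p) 0; last first.
  have [[sp E]|[sp E]] := H f; rewrite {2}/zero_ext.
    by rewrite sp; apply: (near_eq_is_derive E); exact: derivableP.
  rewrite ltNge (ltW sp)/=; apply: (near_eq_is_derive E).
have [fp dfp] := f0 sp; rewrite {2}/zero_ext sp ltxx.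
have zp : zero_ext f p = 0 by rewrite /zero_ext sp ltxx.
suff H : (fun h => h^-1 *: ((zero_ext f \o shift p) (h *: v) - zero_ext f p)) @ 0^' --> (0 : R).
  by split; [apply/cvg_ex; eexists; exact: H|exact: cvg_lim].
have : (fun h => h^-1 *: ((f \o shift p) (h *: v) - f p)) @ 0^' --> 'D_v f p by exact: df.
rewrite dfp.
move=> /cvgr0Pnorm_le cf; apply/cvgr0Pnorm_le => e e0; near=> h.
have : `|h^-1 *: ((f \o shift p) (h *: v) - f p)| <= e by near: h; exact: cf.
apply: le_trans; rewrite zp fp !subr0 !normrM ler_wpM2l//.
exact: norm_zero_ext.
Unshelve. all: by end_near. Qed.

(** Differentiation commutes with [zero_ext] on flat functions, which makes the induction on [k] go
    through. *)
Lemma Ck_on_zero_ext k A f : open A -> Ck_on k A f -> flat_on k A f ->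
  Ck_on k A (zero_ext f).
Proof.
move=> oA; elim: k f => [|k IH] f.
  move=> [cf _] [f0 _]; split=> // p Ap; apply: zero_ext_cont; last exact: cf.
  exact: f0.
move=> Cf [f0 df0]; split=> [p Ap|v].
  by apply: zero_ext_cont; [exact: f0|exact: Ck_on_cont Cf Ap].
have D p : A p -> is_derive p v (zero_ext f) (zero_ext ('D_v f) p).
  move=> Ap; apply: is_derive_zero_ext; last exact: Ck_on_derivable Cf Ap.
  move=> sp; split; first exact: f0.
  by case: k {IH Cf} df0 => [|k] /(_ v)[H _]; exact: H.
split=> [p /D[]//|].
apply: (@eq_Ck_on _ _ _ _ _ (zero_ext ('D_v f))) => //.
  by move=> x /set_mem /D[_ ->].
by apply: IH; [exact: Ck_on_derive|exact: df0].
Qed.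

End FlatExtension.

(** * Plane geometry and gluing across a line *)

Section PlaneGeometry.
Context {R : realType}.
Implicit Types (l : line R) (p q u v w x y : R * R) (A B : set (R * R)).

Lemma fstD u v : (u + v).1 = u.1 + v.1. Proof. by []. Qed.
Lemma sndD u v : (u + v).2 = u.2 + v.2. Proof. by []. Qed.
Lemma fstN u : (- u).1 = - u.1. Proof. by []. Qed.
Lemma sndN u : (- u).2 = - u.2. Proof. by []. Qed.
Lemma fstZ (c : R) u : (c *: u).1 = c * u.1. Proof. by []. Qed.
Lemma sndZ (c : R) u : (c *: u).2 = c * u.2. Proof. by []. Qed.
Definition coordE := (fstD, sndD, fstN, sndN, fstZ, sndZ).

Lemma dotC u v : dot u v = dot v u.
Proof. by rewrite /dot; ring. Qed.

Lemma dotDr u v w : dot u (v + w) = dot u v + dot u w.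
Proof. by rewrite /dot !coordE; ring. Qed.

Lemma dotZr (c : R) u v : dot u (c *: v) = c * dot u v.
Proof. by rewrite /dot !coordE; ring. Qed.

Lemma dotNr u v : dot u (- v) = - dot u v.
Proof. by rewrite /dot !coordE; ring. Qed.

Definition perp v : R * R := (- v.2, v.1).

Lemma dot_perp v : dot v (perp v) = 0.
Proof. by rewrite /dot /perp /=; ring. Qed.

Lemma perp_frame u v : dot u u = 1 -> v = dot u v *: u + dot (perp u) v *: perp u.
Proof.
move=> u1; apply: injective_projections; rewrite !coordE /dot /perp /=.
  by transitivity (v.1 * dot u u); [rewrite u1 mulr1|rewrite /dot; ring].
by transitivity (v.2 * dot u u); [rewrite u1 mulr1|rewrite /dot; ring].
Qed.

Lemma dot_gt0 v : v != 0 -> 0 < dot v v.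
Proof.
case: v => v1 v2 v0; rewrite /dot /= -!expr2 lt_neqAle addr_ge0 ?sqr_ge0// andbT.
apply: contra v0; rewrite eq_sym paddr_eq0 ?sqr_ge0// !sqrf_eq0.
by move=> /andP[/eqP-> /eqP->].
Qed.

Lemma side_affine l (h : R) v x : side l (h *: v + x) = h * dot (normal l) v + side l x.
Proof. by rewrite /side dotDr dotZr; ring. Qed.

Lemma side_cont l : continuous (side l).
Proof.
move=> x; rewrite /side /dot; apply: cvgB; last exact: cvg_cst.
by apply: cvgD; (apply: cvgM; first exact: cvg_cst); [exact: cvg_fst|exact: cvg_snd].
Qed.

Definition linear_reflection l v : R * R :=
  v - (2 * dot (normal l) v / dot (normal l) (normal l)) *: normal l.

Lemma reflection_affine l (h : R) v x :
  reflection l (h *: v + x) = h *: linear_reflection l v + reflection l x.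
Proof.
rewrite /reflection /linear_reflection side_affine.
by apply: injective_projections; rewrite !coordE; ring.
Qed.

Lemma side_reflection l x : side l (reflection l x) = - side l x.
Proof.
have n0 : dot (normal l) (normal l) != 0.
  by rewrite gt_eqF// dot_gt0// normal_neq0.
rewrite /reflection addrC -scaleNr side_affine mulNr divfK//.
by ring.
Qed.

Lemma reflectionK l : involutive (reflection l).
Proof.
move=> x; rewrite {1}/reflection side_reflection /reflection.
by rewrite mulrN mulNr scaleNr opprK subrK.
Qed.

Lemma image_reflection l A : reflection l @` A = reflection l @^-1` A.
Proof.
apply/seteqP; split=> [_ [x Ax <-]|x Ax] /=; first by rewrite reflectionK.
by exists (reflection l x) => //; rewrite reflectionK.
Qed.

Lemma reflection_cont l : continuous (reflection l).
Proof.
move=> x; rewrite /reflection; apply: cvgB; first exact: cvg_id.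
apply: cvgZl; apply: cvgM; last exact: cvg_cst.
by apply: cvgM; [exact: cvg_cst|exact: side_cont].
Qed.

Lemma reflection_point l p : points l p -> reflection l p = p.
Proof. by rewrite /points /= /reflection => ->; rewrite mulr0 mul0r scale0r subr0. Qed.

Lemma linear_reflectionK l : involutive (linear_reflection l).
Proof.
move=> v; have n0 : dot (normal l) (normal l) != 0.
  by rewrite gt_eqF// dot_gt0// normal_neq0.
have H : dot (normal l) (linear_reflection l v) = - dot (normal l) v.
  by rewrite /linear_reflection dotDr dotNr dotZr divfK//; ring.
by rewrite {1}/linear_reflection H mulrN mulNr scaleNr opprK subrK.
Qed.

Lemma dot_linear_reflection l u v :
  dot (linear_reflection l u) (linear_reflection l v) = dot u v.
Proof.
have n0 : dot (normal l) (normal l) != 0.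
  by rewrite gt_eqF// dot_gt0// normal_neq0.
by move: n0; rewrite /linear_reflection /dot !coordE => n0; field.
Qed.

Lemma linear_reflection_normal l (c : R) :
  linear_reflection l (c *: normal l) = - (c *: normal l).
Proof.
have n0 : dot (normal l) (normal l) != 0.
  by rewrite gt_eqF// dot_gt0// normal_neq0.
rewrite /linear_reflection dotZr mulrA mulfK// (_ : 2 * c = c + c); last by ring.
by rewrite scalerDl opprD addrA subrr sub0r.
Qed.

End PlaneGeometry.

(** * Directional derivatives, Laplacian and gluing in the plane *)

Section PlaneCalculus.
Context {R : realType}.
Implicit Types (l : line R) (p q u v w x y : R * R) (A B : set (R * R)).
Implicit Types f g h : R * R -> R.

Lemma derive_tangent0 A f l p : open A -> A p -> points l p ->
  (forall q, A q -> points l q -> f q = 0) -> 'D_(perp (normal l)) f p = 0.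
Proof.
move=> oA Ap lp f0; apply/lim_near_cst => //.
have [e e0 He] := near_along (perp (normal l)) (open_nbhs_nbhs (conj oA Ap)).
near=> h; rewrite /= (f0 p)// subr0 f0 ?scaler0//.
  by rewrite addrC; apply: He; near: h; apply: dnbhs0_le.
by rewrite /points /= side_affine dot_perp mulr0 add0r.
Unshelve. all: by end_near. Qed.

Lemma coordsE v : v = v.1 *: e1 + v.2 *: e2.
Proof.
by apply: injective_projections; rewrite !coordE /e1 /e2 /=; ring.
Qed.

(** Orthonormality is stated for the columns of the matrix with rows [u] and [v]: these sums are the
    coefficients that appear when derivatives along [u] and [v] are expanded in coordinates. *)
Lemma reflection_frame l (u := linear_reflection l e1) (v := linear_reflection l e2) :
  [/\ u.1 ^+ 2 + v.1 ^+ 2 = 1, u.2 ^+ 2 + v.2 ^+ 2 = 1 & u.1 * u.2 + v.1 * v.2 = 0].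
Proof.
have n0 : dot (normal l) (normal l) != 0.
  by rewrite gt_eqF// dot_gt0// normal_neq0.
move: n0; rewrite /u /v /linear_reflection /dot !coordE /e1 /e2 /= => n0.
by split; field.
Qed.

Local Opaque derive e1 e2.

Lemma derive_comb A f p u v (a b : R) : open A -> A p -> Ck_on 1 A f ->
  'D_(a *: u + b *: v) f p = a * 'D_u f p + b * 'D_v f p.
Proof.
move=> oA Ap Cf; rewrite (derive_dirD _ _ oA Ap Cf).
have [_ ->] := is_derive_dirZ a (Ck_on_derivable Cf Ap : derivable f p u).
by have [_ ->] := is_derive_dirZ b (Ck_on_derivable Cf Ap : derivable f p v).
Qed.

Lemma derive_dirN A f p v : A p -> Ck_on 1 A f -> 'D_(- v) f p = - 'D_v f p.
Proof.
move=> Ap Cf; rewrite -scaleN1r.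
have [_ ->] := is_derive_dirZ (-1) (Ck_on_derivable Cf Ap : derivable f p v).
by rewrite scaleN1r.
Qed.

Lemma derive_coords A f p v : open A -> A p -> Ck_on 1 A f ->
  'D_v f p = v.1 * 'D_e1 f p + v.2 * 'D_e2 f p.
Proof. by move=> oA Ap Cf; rewrite {1}(coordsE v) (derive_comb _ _ _ _ oA Ap Cf). Qed.

Lemma derive2_coords A f p u : open A -> A p -> Ck_on 2 A f ->
  'D_u ('D_u f) p = u.1 * (u.1 * 'D_e1 ('D_e1 f) p + u.2 * 'D_e1 ('D_e2 f) p) +
    u.2 * (u.1 * 'D_e2 ('D_e1 f) p + u.2 * 'D_e2 ('D_e2 f) p).
Proof.
move=> oA Ap Cf.
have E w : 'D_w ('D_u f) p = u.1 * 'D_w ('D_e1 f) p + u.2 * 'D_w ('D_e2 f) p.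
  have d v : derivable ('D_v f) p w := Ck_on_derivable (Ck_on_derive _ Cf) Ap.
  have -> : 'D_w ('D_u f) p = 'D_w (u.1 \*: 'D_e1 f + u.2 \*: 'D_e2 f) p.
    apply: near_eq_derive; near=> x.
    rewrite (derive_coords u oA _ (Ck_onW Cf))//.
    by near: x; exact: open_nbhs_nbhs.
  have [_ ->] := is_deriveD (is_deriveZ u.1 (derivableP (d e1)))
    (is_deriveZ u.2 (derivableP (d e2))).
  by [].
have K a b a' b' : a = a' -> b = b' -> u.1 * a + u.2 * b = u.1 * a' + u.2 * b' :> R.
  by move=> -> ->.
exact: etrans (derive_coords u oA Ap (Ck_on_derive u Cf)) (K _ _ _ _ (E e1) (E e2)).
Unshelve. all: by end_near. Qed.

(** Both mixed derivatives come with the coefficient [u.1 * u.2 + v.1 * v.2], which vanishes. *)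
Lemma laplacian_frame A f p u v : open A -> A p -> Ck_on 2 A f ->
  u.1 ^+ 2 + v.1 ^+ 2 = 1 -> u.2 ^+ 2 + v.2 ^+ 2 = 1 -> u.1 * u.2 + v.1 * v.2 = 0 ->
  'D_u ('D_u f) p + 'D_v ('D_v f) p = laplacian f p.
Proof.
move=> oA Ap Cf H1 H2 H3.
have E (u1 u2 v1 v2 a b c d : R) :
    u1 ^+ 2 + v1 ^+ 2 = 1 -> u2 ^+ 2 + v2 ^+ 2 = 1 -> u1 * u2 + v1 * v2 = 0 ->
    u1 * (u1 * a + u2 * b) + u2 * (u1 * c + u2 * d) +
    (v1 * (v1 * a + v2 * b) + v2 * (v1 * c + v2 * d)) = a + d.
  move=> K1 K2 K3; transitivity ((u1 ^+ 2 + v1 ^+ 2) * a +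
    (u1 * u2 + v1 * v2) * (b + c) + (u2 ^+ 2 + v2 ^+ 2) * d); first by ring.
  by rewrite K1 K2 K3; ring.
apply: etrans (congr2 +%R (derive2_coords u oA Ap Cf) (derive2_coords v oA Ap Cf)) _.
exact: E.
Qed.

Lemma derive_frame A f p u v : open A -> A p -> Ck_on 1 A f ->
  u.1 ^+ 2 + v.1 ^+ 2 = 1 -> u.2 ^+ 2 + v.2 ^+ 2 = 1 -> u.1 * u.2 + v.1 * v.2 = 0 ->
  ('D_u f p) ^+ 2 + ('D_v f p) ^+ 2 = ('D_e1 f p) ^+ 2 + ('D_e2 f p) ^+ 2.
Proof.
move=> oA Ap Cf H1 H2 H3.
have E (u1 u2 v1 v2 a b : R) :
    u1 ^+ 2 + v1 ^+ 2 = 1 -> u2 ^+ 2 + v2 ^+ 2 = 1 -> u1 * u2 + v1 * v2 = 0 ->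
    (u1 * a + u2 * b) ^+ 2 + (v1 * a + v2 * b) ^+ 2 = a ^+ 2 + b ^+ 2.
  move=> K1 K2 K3; transitivity ((u1 ^+ 2 + v1 ^+ 2) * a ^+ 2 +
    2 * (u1 * u2 + v1 * v2) * (a * b) + (u2 ^+ 2 + v2 ^+ 2) * b ^+ 2); first by ring.
  by rewrite K1 K2 K3; ring.
have K a b a' b' : a = a' -> b = b' -> a ^+ 2 + b ^+ 2 = a' ^+ 2 + b' ^+ 2 :> R.
  by move=> -> ->.
apply: etrans (K _ _ _ _ (derive_coords u oA Ap Cf) (derive_coords v oA Ap Cf)) _.
exact: E.
Qed.

Lemma laplacian_reflection l A f x : open A -> A (reflection l x) -> Ck_on 2 A f ->
  laplacian (f \o reflection l) x = laplacian f (reflection l x).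
Proof.
move=> oA Ax Cf; have [H1 H2 H3] := reflection_frame l.
have D g v : 'D_v (g \o reflection l) = 'D_(linear_reflection l v) g \o reflection l.
  by apply/funext => y; exact: derive_comp_affine (@reflection_affine _ l) g v y.
have DD v : 'D_v ('D_v (f \o reflection l)) x =
    'D_(linear_reflection l v) ('D_(linear_reflection l v) f) (reflection l x).
  exact: etrans (congr1 (fun g => 'D_v g x) (D f v)) (congr1 (@^~ x) (D _ v)).
apply: etrans (congr2 +%R (DD e1) (DD e2)) _.
exact: laplacian_frame oA Ax Cf H1 H2 H3.
Qed.

Definition energy_density f x : R := f x ^+ 2 + ('D_e1 f x) ^+ 2 + ('D_e2 f x) ^+ 2.

Lemma energy_density_reflection l A f x : open A -> A (reflection l x) -> Ck_on 1 A f ->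
  energy_density (f \o reflection l) x = energy_density f (reflection l x).
Proof.
move=> oA Ax Cf; have [H1 H2 H3] := reflection_frame l.
rewrite /energy_density -!addrA; congr (_ + _).
apply: etrans (derive_frame oA Ax Cf H1 H2 H3).
have K (a b a' b' : R) : a = a' -> b = b' -> a ^+ 2 + b ^+ 2 = a' ^+ 2 + b' ^+ 2.
  by move=> -> ->.
by apply: K; exact: derive_comp_affine (@reflection_affine _ l) f _ _.
Qed.

Lemma derive_frame0 A f p n v : dot n n = 1 -> open A -> A p -> Ck_on 1 A f ->
  'D_n f p = 0 -> 'D_(perp n) f p = 0 -> 'D_v f p = 0.
Proof.
move=> n1 oA Ap Cf fn ft.
have K (a b x y : R) : x = 0 -> y = 0 -> a * x + b * y = 0.
  by move=> -> ->; rewrite !mulr0 addr0.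
rewrite (perp_frame v n1).
exact: etrans (derive_comb n (perp n) _ _ oA Ap Cf) (K _ _ _ _ fn ft).
Qed.

(* The normal-normal derivative is the only one not determined by the Cauchy data on the
   line; it is recovered from the Laplacian. *)
Lemma flat_on_line A h l : dot (normal l) (normal l) = 1 -> open A -> Ck_on 2 A h ->
  (forall p, A p -> points l p ->
     [/\ h p = 0, 'D_(normal l) h p = 0 & laplacian h p = 0]) ->
  flat_on (side l) 2 A h.
Proof.
move=> n1 oA Ch h0; set n := normal l; set t := perp n.
have C1 v : Ck_on 1 A ('D_v h) by exact: Ck_on_derive.
have h00 p : A p -> points l p -> h p = 0 by move=> Ap lp; have [] := h0 p Ap lp.
have Dv0 v p : A p -> points l p -> 'D_v h p = 0.
  move=> Ap lp; have [_ hn _] := h0 p Ap lp.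
  exact: derive_frame0 n1 oA Ap (Ck_onW Ch) hn (derive_tangent0 oA Ap lp h00).
have Dnn p : A p -> points l p -> 'D_n ('D_n h) p = 0.
  move=> Ap lp; have [_ _ L0] := h0 p Ap lp.
  have := @laplacian_frame A h p n t oA Ap Ch.
  have K (x y z : R) : z = 0 -> y = 0 -> x + y = z -> x = 0.
    by move=> -> ->; rewrite addr0.
  move=> H; apply: K L0 (derive_tangent0 oA Ap lp (Dv0 t)) _; apply: H.
  - by rewrite -n1 /t /perp /dot /=; ring.
  - by rewrite -n1 /t /perp /dot /=; ring.
  - by rewrite /t /perp /=; ring.
(* Symmetry turns this into a derivative of ['D_n h], whose normal part is [Dnn] and whose
   tangential part vanishes because ['D_n h] is 0 along the line. *)
have Dnv v p : A p -> points l p -> 'D_n ('D_v h) p = 0.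
  move=> Ap lp; apply: etrans (derive_schwarz n v oA Ap Ch) _.
  exact: derive_frame0 n1 oA Ap (C1 n) (Dnn p Ap lp) (derive_tangent0 oA Ap lp (Dv0 n)).
split; first exact: h00.
move=> v; split; first exact: Dv0.
move=> w; split; last by [].
move=> p Ap lp.
exact: derive_frame0 n1 oA Ap (C1 v) (Dnv v p Ap lp) (derive_tangent0 oA Ap lp (Dv0 v)).
Qed.

Lemma laplacianB A f g p : open A -> A p -> Ck_on 2 A f -> Ck_on 2 A g ->
  laplacian (fun x => f x - g x) p = laplacian f p - laplacian g p.
Proof.
move=> oA Ap Cf Cg; rewrite /laplacian.
have E v : 'D_v ('D_v (fun x => f x - g x)) p = 'D_v ('D_v f) p - 'D_v ('D_v g) p.
  have d (k : R * R -> R) : Ck_on 2 A k -> derivable ('D_v k) p v.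
    by move=> Ck; exact: Ck_on_derivable (Ck_on_derive v Ck) Ap.
  have E1 : 'D_v (fun x => 'D_v f x - 'D_v g x) p = 'D_v ('D_v f) p - 'D_v ('D_v g) p.
    exact: deriveB (d _ Cf) (d _ Cg).
  apply: etrans E1.
  apply: near_eq_derive; near=> x.
  have Ax : A x by near: x; exact: open_nbhs_nbhs.
  exact: deriveB (Ck_on_derivable Cf Ax) (Ck_on_derivable Cg Ax).
have lin (a b c d : R) : a - b + (c - d) = a + c - (b + d) by ring.
exact: etrans (congr2 +%R (E e1) (E e2)) (lin _ _ _ _).
Unshelve. all: by end_near. Qed.

(** The glued function is [g] plus the extension by zero of [f - g], and the hypotheses say exactly
    that [f - g] has zero Cauchy data and zero Laplacian on the line. *)
Lemma glue_C2 A f g l : dot (normal l) (normal l) = 1 -> open A ->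
  Ck_on 2 A f -> Ck_on 2 A g ->
  (forall p, A p -> points l p -> [/\ f p = g p, 'D_(normal l) f p = 'D_(normal l) g p &
     laplacian f p = laplacian g p]) ->
  Ck_on 2 A (fun x => if 0 < side l x then f x else g x).
Proof.
move=> n1 oA Cf Cg fg.
have C : Ck_on 2 A (fun x => f x - g x) by exact: Ck_onB.
apply: (@eq_Ck_on _ _ _ _ _
    (fun x => g x + zero_ext (side l) (fun x => f x - g x) x) _ oA).
  by move=> x _; rewrite /zero_ext; case: ifP => _; [rewrite addrC subrK|rewrite addr0].
apply: (Ck_onD oA Cg); apply: (Ck_on_zero_ext (@side_cont _ l) oA C).
apply: (flat_on_line n1 oA C) => p Ap lp; have [E1 E2 E3] := fg p Ap lp; split.
- by rewrite E1 subrr.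
- have := deriveB (Ck_on_derivable Cf Ap : derivable f p (normal l))
    (Ck_on_derivable Cg Ap).
  move=> E; apply: (etrans E).
  by apply/eqP; rewrite subr_eq0; apply/eqP.
- apply: etrans (laplacianB oA Ap Cf Cg) _.
  by apply/eqP; rewrite subr_eq0; apply/eqP.
Qed.

End PlaneCalculus.

(** * Plane Lebesgue measure *)

Section PlaneMeasure.
Context {R : realType}.
Local Notation M := (measurableTypeR R).
Local Notation mu := (@lebesgue_measure R).
Local Notation mu2 := (@lebesgue_measure R \x @lebesgue_measure R)%E.

(** An open set is the union of the rational boxes it contains, and there are countably many of
    them. *)
Lemma open_measurable2 (A : set (R * R)) : open A -> measurable (A : set (M * M)).
Proof.
move=> oA.
pose box (r : (rat * rat) * (rat * rat)) : set (M * M) :=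
  (`]ratr r.1.1, ratr r.1.2[%classic : set M) `*`
  (`]ratr r.2.1, ratr r.2.2[%classic : set M).
have -> : A = \bigcup_r (if pselect (box r `<=` A) then box r else set0).
  apply/seteqP; split=> [x Ax|x [r _]]; last by case: pselect => // H; exact: H.
  have /nbhs_ballP[e /= e0 He] : nbhs x A by exact: open_nbhs_nbhs.
  have lo (z : R) : z - e < z by rewrite gtrBl.
  have hi (z : R) : z < z + e by rewrite ltrDl.
  have [q1 +] := rat_in_itvoo (hi x.1); have [q2 +] := rat_in_itvoo (hi x.2).
  have [q3 +] := rat_in_itvoo (lo x.1); have [q4 +] := rat_in_itvoo (lo x.2).
  rewrite !in_itv /= => /andP[? ?] /andP[? ?] /andP[? ?] /andP[? ?].
  have xbox : box ((q3, q1), (q4, q2)) x.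
    by split; rewrite /= in_itv /=; apply/andP.
  exists ((q3, q1), (q4, q2)) => //; case: pselect => // boxA; exfalso; apply: boxA.
  move=> y [] /=; rewrite !in_itv /= => /andP[? ?] /andP[? ?].
  by apply: He; split; rewrite /ball /= ltr_norml; apply/andP; split; lra.
apply: countable_bigcupT_measurable; first exact: countableP.
move=> r; case: pselect => rA; last exact: measurable0.
by apply: measurableX; exact: measurable_itv.
Qed.

Lemma open_continuous_measurable_fun2 (A : set (R * R)) (f : R * R -> R) : open A ->
  (forall p, A p -> {for p, continuous f}) -> measurable_fun (A : set (M * M)) (f : M * M -> M).
Proof.
move=> oA cf; apply: (measurability _ (RGenOpens.measurableE R)).
move=> _ [_ [a [b ->] <-]]; apply: open_measurable2.
rewrite openE => p [Ap fp]; apply: filterI; first exact: open_nbhs_nbhs.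
by apply: (cf p Ap); apply: open_nbhs_nbhs; split => //; exact: interval_open.
Qed.

(** The pushforward agrees with Lebesgue measure on half-open intervals, and these determine it. *)
Lemma lebesgue_measure_translation (c : R) (A : set M) : measurable A ->
  mu ((fun x : M => (x + c : M)) @^-1` A) = mu A.
Proof.
move=> mA.
have mT : measurable_fun setT (fun x : M => (x + c : M)).
  by apply: measurable_funD => //; exact: measurable_cst.
pose T : {mfun M >-> M} := HB.pack (fun x : M => (x + c : M)) (isMeasurableFun.Build _ _ _ _ _ mT).
apply/esym/(@lebesgue_measure_unique R (pushforward mu T)) => //= _ [[a b]] _ <-.
rewrite /pushforward.
have -> : T @^-1` `]a, b]%classic = `]a - c, b - c]%classic.
  by apply/seteqP; split=> x /=; rewrite !in_itv /= ltrBlDr lerBrDr.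
rewrite !lebesgue_measure_itv /= !lte_fin ltrD2r.
by case: ifP => // _; rewrite -!EFinD; congr (_%:E); ring.
Qed.

Definition area_preserving (T : M * M -> M * M) : Prop :=
  measurable_fun setT T /\ forall A, measurable A -> mu2 (T @^-1` A) = mu2 A.

Lemma area_preserving_comp T U : area_preserving T -> area_preserving U ->
  area_preserving (T \o U).
Proof.
move=> [mT aT] [mU aU]; split; first exact: measurableT_comp.
move=> A mA; rewrite comp_preimage aU ?aT//.
by rewrite -[X in measurable X]setTI; exact: mT.
Qed.

Lemma area_preserving_swap : area_preserving (fun z => (z.2, z.1)).
Proof.
have mS : measurable_fun setT (fun z : M * M => (z.2, z.1)).
  by apply: measurable_fun_pair; [exact: measurable_snd|exact: measurable_fst].
split=> // A mA.
pose S : {mfun (M * M)%type >-> (M * M)%type} :=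
  HB.pack (fun z : M * M => (z.2, z.1)) (isMeasurableFun.Build _ _ _ _ _ mS).
apply/esym/(@product_measure_unique _ _ _ _ _ mu mu (pushforward mu2 S)) => //= B C mB mC.
rewrite /pushforward.
have -> : S @^-1` (B `*` C) = C `*` B.
  by apply/seteqP; split=> -[x y] /= [].
by rewrite product_measure1E// muleC.
Qed.

(** The product measure integrates the lengths of vertical sections, so a map acting within each
    vertical line need only preserve length there. *)
Lemma area_preserving_fiber (g : M -> M -> M) :
  measurable_fun setT (fun z : M * M => g z.1 z.2) ->
  (forall x (A : set M), measurable A -> mu (g x @^-1` A) = mu A) ->
  area_preserving (fun z => (z.1, g z.1 z.2)).
Proof.
move=> mg ag; split; first by apply: measurable_fun_pair => //; exact: measurable_fst.
move=> A mA; apply: eq_integral => x _ /=.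
rewrite -[RHS](ag x); last exact: measurable_xsection.
by congr (mu _); apply/seteqP; split=> y; rewrite /xsection /= !inE.
Qed.

Lemma area_preserving_shear (k c : R) :
  area_preserving (fun z => (z.1, (z.2 + (k * z.1 + c) : M))).
Proof.
apply: (@area_preserving_fiber (fun x y => y + (k * x + c))).
  apply: measurable_funD; first exact: measurable_snd.
  apply: measurable_funD; last exact: measurable_cst.
  by apply: measurable_funM; [exact: measurable_cst|exact: measurable_fst].
by move=> x A mA; exact: lebesgue_measure_translation.
Qed.

Lemma area_preserving_flip : area_preserving (fun z => (z.1, (- z.2 : M))).
Proof.
apply: (@area_preserving_fiber (fun _ y => - y)).
  by apply: measurableT_comp => //; exact: measurable_snd.
by move=> x A mA; exact: lebesgue_measureN.
Qed.

Lemma eq_area_preserving T U : T =1 U -> area_preserving T -> area_preserving U.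
Proof. by move=> /funext ->. Qed.

(* For [c != -1] the isometry is a product of three shears and a flip, along the classical
   factorisation of a rotation of angle t with shears of slope tan (t / 2) and sin t. *)
Lemma area_preserving_isometry (c s t1 t2 : R) : c ^+ 2 + s ^+ 2 = 1 ->
  area_preserving (fun z => ((c * z.1 + s * z.2 + t1 : M), (s * z.1 - c * z.2 + t2 : M))).
Proof.
move=> cs.
pose S k d (z : M * M) : M * M := (z.1, (z.2 + (k * z.1 + d) : M)).
pose F (z : M * M) : M * M := (z.1, (- z.2 : M)).
pose W (z : M * M) : M * M := (z.2, z.1).
have aS k d : area_preserving (S k d) := area_preserving_shear k d.
have aF : area_preserving F := area_preserving_flip.
have aW : area_preserving W := area_preserving_swap.
have compA T U := @area_preserving_comp T U.
(* The slope [k] below would have a zero denominator here; the linear part is then a mere sign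
   change of the first coordinate. *)
have [c1|c1] := eqVneq c (-1).
  have s0 : s = 0.
    by apply/eqP; rewrite -sqrf_eq0; apply/eqP; move: cs; rewrite c1; lra.
  apply: (@eq_area_preserving (S 0 t2 \o (W \o (S 0 t1 \o (F \o W))))).
    by move=> z; rewrite /S /F /W c1 s0 /=; congr (_, _); ring.
  exact (compA _ _ (aS _ _) (compA _ _ aW (compA _ _ (aS _ _) (compA _ _ aF aW)))).
have c1' : 1 + c != 0 by rewrite addrC addr_eq0.
(* For [c = cos t], [s = sin t] this is [tan (t / 2)], and [ks] is the half-angle identity
   [tan (t / 2) * sin t = 1 - cos t]. *)
pose k := s / (1 + c).
have k1 : k * (1 + c) = s by rewrite divfK.
have ks : k * s = 1 - c.
  apply: (mulIf c1'); rewrite mulrAC k1 -expr2.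
  by apply: (addrI (c ^+ 2)); rewrite cs; ring.
apply: (@eq_area_preserving
  (W \o (S (- k) (k * t2 + t1) \o (W \o (S s t2 \o (F \o (W \o (S k 0 \o W)))))))).
  move=> z; rewrite /S /F /W /=; congr (_, _).
    transitivity ((1 - k * s) * z.1 + (k * (1 + (1 - k * s))) * z.2 + t1); first by ring.
    by rewrite ks opprB addrCA subrr addr0 k1.
  transitivity (s * z.1 + (k * s - 1) * z.2 + t2); first by ring.
  by rewrite ks; ring.
exact (compA _ _ aW (compA _ _ (aS _ _) (compA _ _ aW (compA _ _ (aS _ _)
  (compA _ _ aF (compA _ _ aW (compA _ _ (aS _ _) aW))))))).
Qed.

Lemma area_preserving_reflection (l : line R) : area_preserving (reflection l).
Proof.
have : dot (normal l) (normal l) != 0 by rewrite gt_eqF// dot_gt0// normal_neq0.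
set n := normal l; rewrite /dot => n0; set d := n.1 * n.1 + n.2 * n.2 in n0.
apply: (@eq_area_preserving (fun z =>
  ((1 - 2 * n.1 ^+ 2 / d) * z.1 + (- (2 * n.1 * n.2 / d)) * z.2 + 2 * offset l * n.1 / d : M,
   (- (2 * n.1 * n.2 / d)) * z.1 - (1 - 2 * n.1 ^+ 2 / d) * z.2 + 2 * offset l * n.2 / d : M))).
  move=> z; apply: injective_projections; rewrite !coordE /= /side /dot -/n -/d.
    by field.
  by rewrite /d; field.
by apply: area_preserving_isometry; rewrite /d; field.
Qed.

Lemma integral_area_preserving T (D : set (M * M)) (f : M * M -> \bar R) :
  area_preserving T -> measurable D -> measurable_fun D f -> (forall x, D x -> (0 <= f x)%E) ->
  (\int[mu2]_(x in D) f x = \int[mu2]_(x in T @^-1` D) f (T x))%E.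
Proof.
move=> [mT aT] mD mf f0.
have f0' : {in D, forall x, (0 <= f x)%E} by move=> x /set_mem; exact: f0.
apply: etrans (ge0_integral_pushforward mT mu2 mD mf f0').
by apply: eq_measure_integral => A mA _; exact/esym/aT.
Qed.

Lemma measurable_points (l : line R) : measurable (points l : set (M * M)).
Proof.
have -> : points l = ~` (side l @^-1` (~` [set 0])).
  by rewrite preimage_setC setCK.
apply: measurableC; apply: open_measurable2; apply: open_comp.
  by move=> x _; exact: side_cont.
exact/closed_openC/closed_eq.
Qed.

(** A line that is not vertical meets each vertical line in a single point; the vertical case
    follows by swapping the coordinates. *)
Lemma measure_line0 (l : line R) : mu2 (points l : set (M * M)) = 0%E.
Proof.
wlog n2 : l / (normal l).2 != 0.
  move=> H; have [n2|] := eqVneq (normal l).2 0; last exact: H.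
  have n1 : (normal l).1 != 0.
    by move: (normal_neq0 l); apply: contra => /eqP n1; apply/eqP/injective_projections.
  have n0 : ((normal l).2, (normal l).1) != 0 :> R * R.
    by apply: contra n1 => /eqP[_ ->].
  apply: etrans (H (Line (offset l) n0) n1).
  apply: etrans (esym (proj2 area_preserving_swap _ (measurable_points l))) _.
  congr (mu2 _); apply/seteqP; rewrite /points /side /dot.
  by split=> z /= <-; ring.
apply: integral0_eq => x _ /=.
pose y := (offset l - (normal l).1 * x) / (normal l).2.
suff -> : xsection (points l : set (M * M)) x = [set y] by rewrite lebesgue_measure_set1.
apply/seteqP; split=> z; rewrite /xsection /= inE /points /side /dot /=.
  by move=> H; rewrite /y; apply: (mulIf n2); rewrite divfK//; lra.
by move=> ->; rewrite /y; field.
Qed.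

End PlaneMeasure.

(** * Doubling a domain across a line *)

Section DoubledDomain.
Context {R : realType}.
Implicit Types (l : line R) (p q x y : R * R) (A B K : set (R * R)).

Lemma near_side_gt0 l x : 0 < side l x -> \forall y \near x, 0 < side l y.
Proof. by move=> sx; exact: (cvgr_gt (side l x) (@side_cont R l x) _ sx). Qed.

Lemma near_side_lt0 l x : side l x < 0 -> \forall y \near x, side l y < 0.
Proof. by move=> sx; exact: (cvgr_lt (side l x) (@side_cont R l x) _ sx). Qed.

Lemma near_reflection l x A : (\forall y \near reflection l x, A y) ->
  \forall y \near x, A (reflection l y).
Proof. by move=> H; exact: (reflection_cont H). Qed.

Lemma closure_reflection l A x :
  closure (reflection l @` A) x <-> closure A (reflection l x).
Proof.
rewrite image_reflection; split=> cA B Bx.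
  have [y [Ay By]] := cA _ (near_reflection Bx).
  by exists (reflection l y).
have [|y [Ay By]] := cA (reflection l @^-1` B).
  by apply: near_reflection; rewrite reflectionK.
by exists (reflection l y); split => //; rewrite /preimage /= reflectionK.
Qed.

Lemma closure_near A x : closure A x -> forall P : R * R -> Prop,
  (\forall y \near x, P y) -> exists y, A y /\ P y.
Proof. by move=> cA P /cA [y [Ay Py]]; exists y. Qed.

Lemma closure_side l K x : K `<=` [set y | 0 < side l y] -> closure K x -> 0 <= side l x.
Proof.
move=> Ks cK; rewrite leNgt; apply/negP => /near_side_lt0 /(closure_near cK)[y [/Ks]].
by move=> /= /lt_trans H /H; rewrite ltxx.
Qed.

(* A half-disc adjacent to [l] that contains no boundary point of [K] and meets [K] lies
   in [K], by connectedness. *)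
Lemma half_disc K l p : open K -> K `<=` [set y | 0 < side l y] -> closure K p ->
  (\forall y \near p, closure K y -> 0 < side l y -> K y) ->
  \forall y \near p, K y <-> 0 < side l y.
Proof.
move=> oK Ks cK /nbhs_ballP[e /= e0 He].
have [k [Kk pk]] := closure_near cK (nbhsx_ballx p e e0).
near=> x; split; first exact: Ks.
have px : ball p e x by near: x; exact: nbhsx_ballx.
move=> sx; pose g (t : R) := k + t *: (x - k).
have cg : continuous g.
  by move=> t; apply: cvgD; [exact: cvg_cst|apply: cvgZl; exact: cvg_id].
have gB t : 0 <= t <= 1 -> ball p e (g t) /\ 0 < side l (g t).
  move=> /andP[t0 t1]; have t1' : 0 <= 1 - t by rewrite subr_ge0.
  have conv (a b c : R) : a < c -> b < c -> (1 - t) * a + t * b < c.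
    move=> ac bc; have [->|tn] := eqVneq t 0; first by rewrite subr0 mul1r mul0r addr0.
    have tp : 0 < t by rewrite lt_neqAle eq_sym tn.
    have : t * b < t * c by rewrite ltr_pM2l.
    have : (1 - t) * a <= (1 - t) * c by rewrite ler_wpM2l// ltW.
    lra.
  split; last first.
    have -> : side l (g t) = (1 - t) * side l k + t * side l x.
      by rewrite /g /side !dotDr dotZr dotDr dotNr; ring.
    by have := conv (- side l k) (- side l x) 0; rewrite !oppr_lt0 => /(_ (Ks _ Kk) sx); lra.
  move: pk px => [pk1 pk2] [px1 px2]; move: pk1 pk2 px1 px2.
  rewrite /ball /= !ltr_norml => pk1 pk2 px1 px2.
  have g1 : (g t).1 = (1 - t) * k.1 + t * x.1 by rewrite /g !coordE; ring.
  have g2 : (g t).2 = (1 - t) * k.2 + t * x.2 by rewrite /g !coordE; ring.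
  have conv2 (a b c : R) : - e < a - b < e -> - e < a - c < e ->
      `|a - ((1 - t) * b + t * c)| < e.
    move=> /andP[? ?] /andP[? ?]; rewrite ltr_norml; apply/andP; split.
      rewrite ltrNl (_ : - (a - _) = (1 - t) * (b - a) + t * (c - a)); last by ring.
      by apply: conv; lra.
    rewrite (_ : a - (_ + _) = (1 - t) * (a - b) + t * (a - c)); last by ring.
    by apply: conv; lra.
  suff : ball p.1 e (g t).1 /\ ball p.2 e (g t).2 by [].
  by rewrite g1 g2; split; [exact: (conv2 _ _ _ pk1 px1)|exact: (conv2 _ _ _ pk2 px2)].
have cS : connected (g @` `[0, 1]).
  apply: connected_continuous_connected; first exact: segment_connected.
  exact: continuous_subspaceT.
have g0 : g 0 = k by rewrite /g scale0r addr0.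
have g1 : g 1 = x by rewrite /g scale1r addrC subrK.
(* On the segment from [k] to [x], membership in [K] is a relatively open condition, and a
   relatively closed one since points of [closure K] in the half-disc lie in [K]. It holds at [k],
   hence along the whole segment. *)
have := cS (g @` `[0, 1] `&` K).
move=> H; have {H} E : g @` `[0, 1] `&` K = g @` `[0, 1].
  apply: H.
  - by exists k; split => //; exists 0 => //; rewrite /= in_itv /= lexx ler01.
  - by exists K.
  - exists (closure K); first exact: closed_closure.
    apply/seteqP; split=> y [] yg; first by move=> Ky; split=> //; exact: subset_closure.
    move=> cKy; split=> //; case: yg => t; rewrite /= in_itv /= => /gB[By sy] ty.
    by rewrite -ty in cKy *; exact: He.
have : (g @` `[0, 1] `&` K) x.
  by rewrite E; exists 1 => //; rewrite /= in_itv /= lexx ler01.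
by case.
Unshelve. all: by end_near. Qed.

Lemma closure_half_disc K l p : points l p ->
  (\forall y \near p, 0 < side l y -> K y) -> closure K p.
Proof.
move=> lp Kp B Bp.
have [e e0 He] := near_along (normal l) (filterI Bp Kp).
have ee : `|e| <= e by rewrite ger0_norm// ltW.
have [By Ky] := He e ee.
exists (p + e *: normal l); split=> //; apply: Ky.
by rewrite addrC side_affine lp addr0 mulr_gt0// dot_gt0// normal_neq0.
Qed.

Definition doubled l K := interior (closure (K `|` reflection l @` K)).

(* The part of the boundary of [K] along the axis [l], that is, the part of the doubled
   domain on [l] (see [doubled_line]). *)
Definition straight l K := relint (boundary K) (boundary K `&` points l).

Section Doubling.
Variables (l : line R) (K : set (R * R)).
Hypotheses (oK : open K) (regK : interior (closure K) `<=` K).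
Hypothesis Kside : K `<=` [set y | 0 < side l y].
Local Notation T := (reflection l).
Local Notation Om := (doubled l K).

Lemma closure_doubled x : closure (K `|` T @` K) x <-> closure K x \/ closure K (T x).
Proof.
by rewrite closureU; split=> -[|/closure_reflection];
  by [left|right|right; apply/closure_reflection].
Qed.

Lemma open_doubled : open Om.
Proof. exact: open_interior. Qed.

Lemma doubled_sym x : Om (T x) <-> Om x.
Proof.
have H y : Om y -> Om (T y).
  move=> Oy; rewrite /doubled /interior /=.
  have : \forall z \near T y, closure (K `|` T @` K) (T z).
    by apply: near_reflection; rewrite reflectionK.
  by apply: filterS => z /closure_doubled H; apply/closure_doubled; move: H;
    rewrite reflectionK => -[]; [right|left].
by split=> [/H|/H //]; rewrite reflectionK.
Qed.

(** Strictly on the positive side the closure of the mirror image is absent, so the doubled domain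
    is locally the interior of [closure K], and [regK] applies. *)
Lemma doubled_pos x : 0 < side l x -> (Om x <-> K x).
Proof.
move=> sx; split=> [Ox|Kx].
  apply: regK; rewrite /interior /=.
  near=> y; have : closure (K `|` T @` K) y by near: y; exact: Ox.
  move=> /closure_doubled[//|/(closure_side Kside)]; rewrite side_reflection oppr_ge0 leNgt.
  by move=> /negP H; exfalso; apply: H; near: y; exact: near_side_gt0.
apply: (@interiorS _ K); last by rewrite ((interior_id K).1 oK).
by move=> y Ky; apply: subset_closure; left.
Unshelve. all: by end_near. Qed.

Lemma doubled_neg x : side l x < 0 -> (Om x <-> K (T x)).
Proof.
move=> sx; rewrite -doubled_sym; apply: doubled_pos.
by rewrite side_reflection oppr_gt0.
Qed.

(** The relative interior in [straight] says that boundary points near [p] lie on [l], so the open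
    half-disc contains none and [half_disc] applies. *)
Lemma straight_near p : straight l K p -> \forall x \near p, K x <-> 0 < side l x.
Proof.
move=> [[[cK _] _] near_p]; apply: half_disc => //.
apply: filterS near_p => y H cy sy; apply: contrapT => nK.
have [|_] := H; last by rewrite /points /= => s0; rewrite s0 ltxx in sy.
by split=> // /interior_subset.
Qed.

Lemma straight_points p : straight l K p -> points l p. Proof. by case=> -[]. Qed.

Lemma straight_boundary p : straight l K p -> boundary K p. Proof. by case=> -[]. Qed.

Lemma half_disc_straight p : points l p ->
  (\forall x \near p, K x <-> 0 < side l x) -> straight l K p.
Proof.
move=> lp Kp.
have bd q : points l q -> (\forall x \near q, K x <-> 0 < side l x) -> boundary K q.
  move=> lq Kq; split.
    by apply: (closure_half_disc lq); apply: filterS Kq => y [].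
  by move=> /interior_subset /Kside /=; rewrite lq ltxx.
split; first by split=> //; exact: bd.
have := near_join Kp; apply: filterS => q Kq [cq nq]; split=> //.
have : 0 <= side l q by exact: closure_side cq.
rewrite le_eqVlt => /orP[/eqP//|sq]; exfalso; apply: nq.
by rewrite ((interior_id K).1 oK); apply/(nbhs_singleton Kq).
Qed.

Lemma straight_nbhs p : straight l K p -> \forall q \near p, points l q -> straight l K q.
Proof.
move=> /straight_near /near_join; apply: filterS => q Kq lq; exact: half_disc_straight.
Qed.

(** A disc around an axis point of the doubled domain has its positive half in [K]. Conversely a
    half-disc of [K], its mirror image and the diameter between them fill a disc within the
    closure. *)
Lemma doubled_line x : points l x -> (Om x <-> straight l K x).
Proof.
move=> lx; split=> [Ox|ax].
  apply: half_disc_straight => //.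
  have : \forall y \near x, Om y by apply: open_nbhs_nbhs; split=> //; exact: open_doubled.
  apply: filterS => y Oy; split; first exact: Kside.
  by move=> sy; apply/(doubled_pos sy).
have Kx := straight_near ax.
have Kx' : \forall y \near x, K (T y) <-> 0 < side l (T y).
  by apply: (@near_reflection l x (fun z => K z <-> 0 < side l z)); rewrite reflection_point.
have := near_join Kx; rewrite /doubled /interior /=.
move=> Kxx; near=> y; apply/closure_doubled.
have Ky : \forall z \near y, K z <-> 0 < side l z by near: y.
have Ky' : K (T y) <-> 0 < side l (T y) by near: y.
have [sy|sy|sy] := ltrgt0P (side l y).
- by left; apply: subset_closure; apply/(nbhs_singleton Ky).
- by right; apply: subset_closure; apply/Ky'; rewrite side_reflection oppr_gt0.
- by left; apply: (closure_half_disc sy); apply: filterS Ky => z [].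
Unshelve. all: by end_near. Qed.

End Doubling.

(** A short step from [p] along [n] makes the defining function positive, its derivative there being
    [c > 0], and no point of [A] is near a point where it is positive. *)
Lemma not_interior_closure_smooth A p n : outer_normal A p n -> ~ interior (closure A) p.
Proof.
move=> [U [phi [c [Up sphi UA p0 [nn c0 dphi]]]]] icA.
have dn : 'D_n phi p = c by rewrite dphi nn mulr1.
have df : derivable phi p n by apply: (Ck_on_derivable (sphi 1%N)); case: Up.
have [e e0 He] := near_along n (filterI (open_nbhs_nbhs Up) icA).
have : (fun h => h^-1 *: ((phi \o shift p) (h *: n) - phi p)) @ 0^' --> c.
  by rewrite -dn; exact: df.
move=> /cvgr_gt /(_ 0 c0) /= [d /= d0 Hd].
pose h := Num.min e (d / 2).
have h0 : 0 < h by rewrite /h lt_min e0 divr_gt0.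
have hd : h < d by rewrite /h gt_min ltr_pdivrMr// ltr_pMr// ltr1n orbT.
have := Hd h; rewrite /ball /= sub0r normrN gtr0_norm// => /(_ hd).
rewrite gt_eqF// => /(_ isT); rewrite p0 subr0 => ph.
have {ph} ph : 0 < phi (p + h *: n).
  by rewrite addrC; move: ph; rewrite /= pmulr_rgt0 ?invr_gt0.
have he : `|h| <= e by rewrite gtr0_norm// /h ge_min lexx.
have [Ux cx] := He h he.
have oU : open U by case: Up.
have cphi : {for p + h *: n, continuous phi} by exact: Ck_on_cont (sphi 0%N) Ux.
have [y [Ay [Uy]]] := closure_near cx (filterI (open_nbhs_nbhs (conj oU Ux))
   (cvgr_gt _ cphi _ ph)).
by have /UA := Ay; move=> /(_ Uy) /lt_trans H /H; rewrite ltxx.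
Qed.

(* Were a boundary point interior to the closure of A, then an arc of the boundary through
   it would consist of nonsmooth points, whereas it is infinite. *)
Lemma piecewise_smooth_regular A : open A -> piecewise_smooth_boundary A ->
  interior (closure A) `<=` A.
Proof.
move=> oA [[m [g [sg bdE]]] finF] p icp; apply: contrapT => nA.
set F := [set p | _] in finF.
have bdp : boundary A p by split; [exact: interior_subset icp|rewrite ((interior_id A).1 oA)].
move: (bdp); rewrite bdE => -[i _ [t t01 gt]].
have [sgi dgi] := sg i.
have cg : continuous (g i) by move=> s; apply: Ck_on_cont (sgi 0%N) _.
have Fbad : \forall s \near t, s \in `[0, 1] -> F (g i s).
  have : \forall s \near t, interior (closure A) (g i s).
    by apply: (cg t); rewrite gt; exact: nbhs_interior.
  apply: filterS => s ics s01; split; first by rewrite bdE; exists i => //; exists s.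
  by move=> [n /not_interior_closure_smooth]; apply.
have dg : derivable (g i) t 1 by exact: Ck_on_derivable (sgi 1%N) _.
(* The velocity at [t] is nonzero, so the arc does not return to [g i t] at nearby parameters. *)
have gneq : \forall h \near (0 : R)^', g i (h *: (1 : R) + t) != g i t.
  have H := cvgr_neq0 _ dg (dgi _ t01); near=> h.
  have : h^-1 *: ((g i \o shift t) (h *: (1 : R)) - g i t) != 0 by near: h; exact: H.
  by apply: contra => /eqP /= ->; rewrite subrr scaler0.
have Fclosed : closed (F `\ p).
  have <- : \bigcup_(q in F `\ p) [set q] = F `\ p by rewrite bigcup_imset1 image_id.
  apply: closed_bigcup; first exact: finite_setD.
  by move=> q _; exact/accessible_closed_set1/hausdorff_accessible/norm_hausdorff.
have Fneq : \forall s \near t, ~ (F `\ p) (g i s).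
  have oF : open (~` (F `\ p)) by exact: closed_openC.
  have tF : (~` (F `\ p)) (g i t) by rewrite gt => -[_ /(_ erefl)].
  exact: (cg t _ (open_nbhs_nbhs (conj oF tF))).
have [e e0 He] := near_along (1 : R) (filterI Fbad Fneq).
move: gneq => [d /= d0 Hd].
(* The bound 1/2 ensures that [t + h] or [t - h] is still in the unit interval, since [t] may be an
   end point. *)
pose h := Num.min (Num.min e (d / 2)) (1 / 2).
have h0 : 0 < h by rewrite /h !lt_min e0 !divr_gt0.
have hd : h < d by rewrite /h !gt_min ltr_pdivrMr// ltr_pMr// ltr1n !orbT.
have he : h <= e by rewrite /h !ge_min lexx.
have h2 : h <= 1 / 2 by rewrite /h !ge_min lexx !orbT.
have bad s : `|s| = h -> t + s \in `[0, 1] -> False.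
  move=> sh s01; have [] := He s; first by rewrite sh.
  rewrite [s *: 1]mulr1 => /(_ s01) Fs; apply; split=> // gs.
  have /negP[] : g i (s *: (1 : R) + t) != g i t.
    apply: Hd; first by rewrite /= sub0r normrN sh.
    by rewrite -normr_gt0 sh.
  by rewrite [s *: 1]mulr1 addrC gs gt.
move: t01; rewrite /= in_itv /= => /andP[t0 t1].
have [t2|t2] := leP t (1 / 2).
  by apply: (bad h); rewrite ?gtr0_norm// in_itv /=; apply/andP; split; lra.
by apply: (bad (- h)); rewrite ?normrN ?gtr0_norm// in_itv /=; apply/andP; split; lra.
Unshelve. all: by end_near. Qed.

End DoubledDomain.

(** * The mixed problem *)

Section Energy.
Context {R : realType}.
Local Notation M := (measurableTypeR R).
Local Notation mu2 := (@lebesgue_measure R \x @lebesgue_measure R)%E.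
Implicit Types (l : line R) (A B Om : set (R * R)) (u v f g : R * R -> R).
Local Opaque derive e1 e2.

Lemma energy_density_ge0 u x : 0 <= energy_density u x.
Proof. by rewrite /energy_density !addr_ge0// sqr_ge0. Qed.

Lemma energyE A u : energy A u = (\int[mu2]_(x in A) (energy_density u x)%:E)%E.
Proof. by []. Qed.

Lemma measurable_energy_density A u : open A -> Ck_on 1 A u ->
  measurable_fun (A : set (M * M)) (fun x => (energy_density u x)%:E).
Proof.
move=> oA Cu; apply/measurable_EFinP; apply: open_continuous_measurable_fun2 => // p Ap.
have sq (w : R * R -> R) : {for p, continuous w} -> {for p, continuous (fun x => w x ^+ 2)}.
  by move=> cw; exact: (cvgM cw cw).
have cu := sq _ (Ck_on_cont Cu Ap).
have c1 := sq _ (Ck_on_cont (Ck_on_derive e1 Cu) Ap).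
have c2 := sq _ (Ck_on_cont (Ck_on_derive e2 Cu) Ap).
exact: (cvgD (cvgD cu c1) c2).
Qed.

Lemma eq_energy_density A u v x : open A -> {in A, u =1 v} -> A x ->
  energy_density u x = energy_density v x.
Proof.
move=> oA uv Ax.
have E : \forall y \near x, u y = v y.
  by near=> y; apply/uv/mem_set; near: y; exact: open_nbhs_nbhs.
have K (a b c a' b' c' : R) : a = a' -> b = b' -> c = c' ->
  a ^+ 2 + b ^+ 2 + c ^+ 2 = a' ^+ 2 + b' ^+ 2 + c' ^+ 2 by move=> -> -> ->.
exact: K (nbhs_singleton E) (near_eq_derive _ E) (near_eq_derive _ E).
Unshelve. all: by end_near. Qed.

Lemma eq_energy A u v : open A -> {in A, u =1 v} -> energy A u = energy A v.
Proof.
move=> oA uv; rewrite !energyE; apply: eq_integral => x /set_mem Ax.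
by rewrite (eq_energy_density oA uv Ax).
Qed.

Lemma energy_reflection l A u : open A -> Ck_on 1 A u ->
  energy (reflection l @^-1` A) (u \o reflection l) = energy A u.
Proof.
move=> oA Cu; rewrite !energyE.
have mA := open_measurable2 oA.
have mu := measurable_energy_density oA Cu.
have u0 x : A x -> (0 <= (energy_density u x)%:E)%E.
  by rewrite lee_fin energy_density_ge0.
apply: etrans (esym (integral_area_preserving (area_preserving_reflection l) mA mu u0)).
apply: eq_integral => x /set_mem Ax.
by rewrite (energy_density_reflection oA Ax Cu).
Qed.

Lemma energy_subset A B u : open A -> open B -> Ck_on 1 B u -> A `<=` B ->
  (energy A u <= energy B u)%E.
Proof.
move=> oA oB Cu AB; rewrite !energyE; apply: ge0_subset_integral => //.
- exact: open_measurable2.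
- exact: open_measurable2.
- exact: measurable_energy_density.
- by move=> x _; rewrite lee_fin energy_density_ge0.
Qed.

(** The inequality [(x + y)^2 <= 2 x^2 + 2 y^2] is applied to the values and to both partial
    derivatives; the gap in [K] is a sum of squares. *)
Lemma energy_comb A u v (a b : R) : open A -> Ck_on 1 A u -> Ck_on 1 A v ->
  (energy A u < +oo)%E -> (energy A v < +oo)%E ->
  (energy A (fun x => (a * u x + b * v x)%R) < +oo)%E.
Proof.
move=> oA Cu Cv; rewrite !energyE => Eu Ev.
have mA := open_measurable2 oA.
have mu := measurable_energy_density oA Cu.
have mv := measurable_energy_density oA Cv.
have pos (k : R) w (x : M * M) : A x -> (0 <= ((2 * k ^+ 2) * energy_density w x)%:E)%E.
  by move=> _; rewrite lee_fin mulr_ge0 ?energy_density_ge0// mulr_ge0// sqr_ge0.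
have m (k : R) w : measurable_fun (A : set (M * M)) (fun x => (energy_density w x)%:E) ->
    measurable_fun (A : set (M * M)) (fun x => ((2 * k ^+ 2) * energy_density w x)%:E).
  move=> /measurable_EFinP mw; apply/measurable_EFinP.
  by apply: measurable_funM => //; exact: measurable_cst.
have fin (k : R) w : measurable_fun (A : set (M * M)) (fun x => (energy_density w x)%:E) ->
    (\int[mu2]_(x in A) (energy_density w x)%:E < +oo)%E ->
    (\int[mu2]_(x in A) ((2 * k ^+ 2) * energy_density w x)%:E < +oo)%E.
  move=> mw fw.
  have k0 : 0 <= 2 * k ^+ 2 by rewrite mulr_ge0// sqr_ge0.
  have w0 (x : M * M) : A x -> (0 <= (energy_density w x)%:E)%E.
    by rewrite lee_fin energy_density_ge0.
  have -> : (\int[mu2]_(x in A) ((2 * k ^+ 2) * energy_density w x)%:E =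
     (2 * k ^+ 2)%:E * \int[mu2]_(x in A) (energy_density w x)%:E)%E.
    exact: (ge0_integralZl_EFin mu2 mA w0 mw k0).
  by apply: lte_mul_pinfty; rewrite ?lee_fin// fin_numE.
apply: le_lt_trans (_ : (\int[mu2]_(x in A) (((2 * a ^+ 2) * energy_density u x)%:E +
    ((2 * b ^+ 2) * energy_density v x)%:E) < +oo)%E); last first.
  rewrite (ge0_integralD mu2 mA (pos a u) (m a u mu) (pos b v) (m b v mv)).
  exact: lte_add_pinfty (fin a u mu Eu) (fin b v mv Ev).
have Cc : Ck_on 1 A (fun x => a * u x + b * v x).
  exact: Ck_onD oA (Ck_onZ a oA Cu) (Ck_onZ b oA Cv).
apply: ge0_le_integral => //.
- by move=> x _; rewrite lee_fin energy_density_ge0.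
- exact: measurable_energy_density.
- by apply: emeasurable_funD; exact: m.
move=> x Ax; rewrite -EFinD lee_fin.
have D w : 'D_w (fun x => a * u x + b * v x) x = a * 'D_w u x + b * 'D_w v x.
  have du : derivable u x w := Ck_on_derivable Cu Ax.
  have dv : derivable v x w := Ck_on_derivable Cv Ax.
  have [_ E] := is_deriveD (is_deriveZ a (derivableP du)) (is_deriveZ b (derivableP dv)).
  exact: E.
have K (p q r p' q' r' s t : R) : s = a * q + b * q' -> t = a * r + b * r' ->
    (a * p + b * p') ^+ 2 + s ^+ 2 + t ^+ 2 <=
    (2 * a ^+ 2) * (p ^+ 2 + q ^+ 2 + r ^+ 2) + (2 * b ^+ 2) * (p' ^+ 2 + q' ^+ 2 + r' ^+ 2).
  move=> -> ->; rewrite -subr_ge0.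
  rewrite (_ : _ - _ = (a * p - b * p') ^+ 2 + (a * q - b * q') ^+ 2 + (a * r - b * r') ^+ 2).
    by rewrite !addr_ge0// sqr_ge0.
  by ring.
exact: K (D e1) (D e2).
Qed.

Lemma energy_null_split Om A B (N : set (R * R)) u : open Om -> open A -> open B ->
  Ck_on 1 Om u -> measurable (N : set (M * M)) -> mu2 N = 0%E ->
  Om `\` N = A `|` B -> A `&` B = set0 ->
  energy Om u = (energy A u + energy B u)%E.
Proof.
move=> oOm oA oB Cu mN N0 OmE AB; rewrite !energyE.
have mOm := open_measurable2 oOm.
have mu := measurable_energy_density oOm Cu.
have u0 (D : set (M * M)) x : D x -> (0 <= (energy_density u x)%:E)%E.
  by rewrite lee_fin energy_density_ge0.
rewrite (ge0_negligible_integral mN mOm mu (u0 _) N0) OmE.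
apply: ge0_integral_setU.
- exact: open_measurable2.
- exact: open_measurable2.
- by rewrite -OmE; apply: measurable_funS mu => // x [].
- exact: u0.
- by rewrite disj_set2E AB.
Qed.

End Energy.

(** * Boundary conditions: locality, linearity and reflection *)

Section MixedProblem.
Context {R : realType}.
Implicit Types (l : line R) (p q n : R * R) (A B Om D N : set (R * R)) (u v w f g : R * R -> R).
Local Opaque derive e1 e2.

Lemma outer_normal_near A B p n : (\forall x \near p, A x <-> B x) ->
  outer_normal A p n -> outer_normal B p n.
Proof.
move=> AB [U [phi [c [[oU Up] sphi UA p0 H]]]].
exists (U `&` interior [set x | A x <-> B x]), phi, c; split=> //.
- split; first by apply: openI => //; exact: open_interior.
  by split.
- by move=> k; apply: Ck_onS (sphi k) => x [].
- by move=> x [Ux /interior_subset [H1 H2]]; have [K1 K2] := UA x Ux; split; auto.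
Qed.

Lemma outer_normal_reflection l A p n : outer_normal A p n ->
  outer_normal (reflection l @^-1` A) (reflection l p) (linear_reflection l n).
Proof.
move=> [U [phi [c [[oU Up] sphi UA p0 [nn c0 dphi]]]]].
exists (reflection l @^-1` U), (phi \o reflection l), c; split.
- split; last by rewrite /preimage /= reflectionK.
  by apply: open_comp => // x _; exact: reflection_cont.
- move=> k.
  exact: Ck_on_comp_affine (@reflection_affine _ l) _ _ _ (@reflection_cont _ l) (sphi k).
- by move=> x Ux; exact: UA.
- by rewrite /= reflectionK.
split=> //; first by rewrite dot_linear_reflection.
move=> v; apply: etrans (derive_comp_affine (@reflection_affine _ l) phi v _) _.
by rewrite reflectionK dphi -(dot_linear_reflection l _ (linear_reflection l v)) linear_reflectionK.
Qed.

Lemma C2_extension_near A B p u v w : (\forall x \near p, B x -> A x /\ u x = v x) ->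
  C2_extension A p u w -> C2_extension B p v w.
Proof.
move=> AB [U [[oU Up] Cw wu]].
exists (U `&` interior [set x | B x -> A x /\ u x = v x]); split.
- split; first by apply: openI => //; exact: open_interior.
  by split.
- by apply: Ck_onS Cw => x [].
- by move=> x [Ux /interior_subset ABx] /ABx [Ax <-]; exact: wu.
Qed.

Lemma C2_extension_reflection l A p u w : C2_extension A p u w ->
  C2_extension (reflection l @^-1` A) (reflection l p) (u \o reflection l) (w \o reflection l).
Proof.
move=> [U [[oU Up] Cw wu]]; exists (reflection l @^-1` U); split.
- split; last by rewrite /preimage /= reflectionK.
  by apply: open_comp => // x _; exact: reflection_cont.
- exact: Ck_on_comp_affine (@reflection_affine _ l) _ _ _ (@reflection_cont _ l) Cw.
- by move=> x Ux Ax; exact: wu.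
Qed.

Lemma C2_extension_comb A p u v w z (a b : R) : C2_extension A p u w -> C2_extension A p v z ->
  C2_extension A p (fun x => a * u x + b * v x) (fun x => a * w x + b * z x).
Proof.
move=> [U [[oU Up] Cw wu]] [V [[oV Vp] Cz zv]].
have oUV : open (U `&` V) by exact: openI.
exists (U `&` V); split; first by split.
- apply: (Ck_onD oUV); apply: (Ck_onZ _ oUV).
    by apply: Ck_onS Cw => x [].
  by apply: Ck_onS Cz => x [].
- by move=> x [Ux Vx] Ax; rewrite wu// zv.
Qed.

Lemma C2_extension_self A p u : open A -> A p -> Ck_on 2 A u -> C2_extension A p u u.
Proof. by move=> oA Ap Cu; exists A. Qed.

Lemma derive_comb_fun A p u v n (a b : R) : open A -> A p -> Ck_on 1 A u -> Ck_on 1 A v ->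
  'D_n (fun x => a * u x + b * v x) p = a * 'D_n u p + b * 'D_n v p.
Proof.
move=> oA Ap Cu Cv.
have du : derivable u p n := Ck_on_derivable Cu Ap.
have dv : derivable v p n := Ck_on_derivable Cv Ap.
have [_ E] := is_deriveD (is_deriveZ a (derivableP du)) (is_deriveZ b (derivableP dv)).
exact: E.
Qed.

Lemma derive_C2_extension_comb A p u v w z n (a b : R) :
  C2_extension A p u w -> C2_extension A p v z ->
  'D_n (fun x => a * w x + b * z x) p = a * 'D_n w p + b * 'D_n z p.
Proof.
move=> [U [[oU Up] Cw wu]] [V [[oV Vp] Cz zv]].
apply: (@derive_comb_fun (U `&` V)) => //; first exact: openI.
  by apply: Ck_onS (Ck_onW Cw) => x [].
by apply: Ck_onS (Ck_onW Cz) => x [].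
Qed.

Lemma laplacian_comb A p u v (a b : R) : open A -> A p -> Ck_on 2 A u -> Ck_on 2 A v ->
  laplacian (fun x => a * u x + b * v x) p = a * laplacian u p + b * laplacian v p.
Proof.
move=> oA Ap Cu Cv.
have E n : 'D_n ('D_n (fun x => a * u x + b * v x)) p = a * 'D_n ('D_n u) p + b * 'D_n ('D_n v) p.
  apply: etrans (derive_comb_fun n a b oA Ap (Ck_on_derive n Cu) (Ck_on_derive n Cv)).
  apply: near_eq_derive; near=> x.
  have Ax : A x by near: x; exact: open_nbhs_nbhs.
  exact: derive_comb_fun oA Ax (Ck_onW Cu) (Ck_onW Cv).
have K (x y z t : R) : a * x + b * y + (a * z + b * t) = a * (x + z) + b * (y + t) by ring.
exact: etrans (congr2 +%R (E e1) (E e2)) (K _ _ _ _).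
Unshelve. all: by end_near. Qed.

Lemma eq_laplacian A p u v : open A -> A p -> {in A, u =1 v} -> laplacian u p = laplacian v p.
Proof.
move=> oA Ap uv.
have E : \forall y \near p, u y = v y.
  by near=> y; apply/uv/mem_set; near: y; exact: open_nbhs_nbhs.
have E2 n : 'D_n ('D_n u) p = 'D_n ('D_n v) p.
  exact: near_eq_derive (near_eq_derive_near n E).
have K (a b a' b' : R) : a = a' -> b = b' -> a + b = a' + b' by move=> -> ->.
exact: K (E2 e1) (E2 e2).
Unshelve. all: by end_near. Qed.

Variable lam : R.

(** This and [neumann] isolate the boundary clauses of [mixed_solution], so that they can be
    localised and reassembled from different parts of the boundary. *)
Definition dirichlet Om D u := forall p n, outer_normal Om p n -> D p ->
  exists w, C2_extension Om p u w /\ w p = 0.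

Definition neumann Om N u := forall p n, outer_normal Om p n -> N p ->
  exists w, C2_extension Om p u w /\ 'D_n w p = 0.

Lemma dirichlet_near A B D u v :
  (forall p, D p -> \forall x \near p, (A x <-> B x) /\ (B x -> u x = v x)) ->
  dirichlet A D u -> dirichlet B D v.
Proof.
move=> AB du p n np Dp; have AB' := AB p Dp.
have nA : outer_normal A p n.
  by apply: outer_normal_near np; apply: filterS AB' => x [[? ?] _].
have [w [Cw w0]] := du p n nA Dp; exists w; split=> //.
by apply: C2_extension_near Cw; apply: filterS AB' => x [[? ?] H] ?; split; auto.
Qed.

Lemma neumann_near A B N u v :
  (forall p, N p -> \forall x \near p, (A x <-> B x) /\ (B x -> u x = v x)) ->
  neumann A N u -> neumann B N v.
Proof.
move=> AB du p n np Dp; have AB' := AB p Dp.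
have nA : outer_normal A p n.
  by apply: outer_normal_near np; apply: filterS AB' => x [[? ?] _].
have [w [Cw w0]] := du p n nA Dp; exists w; split=> //.
by apply: C2_extension_near Cw; apply: filterS AB' => x [[? ?] H] ?; split; auto.
Qed.

Lemma dirichletS A D D' u : D' `<=` D -> dirichlet A D u -> dirichlet A D' u.
Proof. by move=> DD du p n np /DD; exact: (du _ _ np). Qed.

Lemma neumannS A D D' u : D' `<=` D -> neumann A D u -> neumann A D' u.
Proof. by move=> DD du p n np /DD; exact: (du _ _ np). Qed.

Lemma dirichletU A D D' u : dirichlet A D u -> dirichlet A D' u -> dirichlet A (D `|` D') u.
Proof. by move=> d1 d2 p n np [H|H]; [exact: (d1 _ _ np H)|exact: (d2 _ _ np H)]. Qed.

Lemma neumannU A D D' u : neumann A D u -> neumann A D' u -> neumann A (D `|` D') u.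
Proof. by move=> d1 d2 p n np [H|H]; [exact: (d1 _ _ np H)|exact: (d2 _ _ np H)]. Qed.

Lemma mixed_solution_comb Om D N u v (a b : R) : open Om ->
  mixed_solution Om D N lam u -> mixed_solution Om D N lam v ->
  mixed_solution Om D N lam (fun x => a * u x + b * v x).
Proof.
move=> oO [Cu Lu Eu Du Nu] [Cv Lv Ev Dv Nv]; split.
- exact: Ck_onD oO (Ck_onZ a oO Cu) (Ck_onZ b oO Cv).
- move=> x Ox.
  have K (y z t s r : R) : t = a * y + b * z -> - y = lam * s -> - z = lam * r ->
      - t = lam * (a * s + b * r).
    by move=> ->; rewrite opprD -!mulrN => -> ->; ring.
  exact: K (laplacian_comb a b oO Ox Cu Cv) (Lu x Ox) (Lv x Ox).
- exact: energy_comb oO (Ck_onW Cu) (Ck_onW Cv) Eu Ev.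
- move=> p n np Dp; have [w [Cw w0]] := Du p n np Dp; have [z [Cz z0]] := Dv p n np Dp.
  exists (fun x => a * w x + b * z x); split; first exact: C2_extension_comb.
  by rewrite w0 z0 !mulr0 addr0.
- move=> p n np Dp; have [w [Cw w0]] := Nu p n np Dp; have [z [Cz z0]] := Nv p n np Dp.
  exists (fun x => a * w x + b * z x); split; first exact: C2_extension_comb.
  apply: etrans (derive_C2_extension_comb n a b Cw Cz) _.
  have K (x y : R) : x = 0 -> y = 0 -> a * x + b * y = 0 by move=> -> ->; ring.
  exact: K.
Qed.

Lemma mixed_solution_reflection l Om D N u : open Om -> mixed_solution Om D N lam u ->
  mixed_solution (reflection l @^-1` Om) (reflection l @^-1` D) (reflection l @^-1` N)
    lam (u \o reflection l).
Proof.
move=> oO [Cu Lu Eu Du Nu]; set T := reflection l.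
have nT p n : outer_normal (T @^-1` Om) p n -> outer_normal Om (T p) (linear_reflection l n).
  move=> /(outer_normal_reflection l); apply: outer_normal_near; near=> x.
  by rewrite /preimage /T /= reflectionK.
split.
- exact: Ck_on_comp_affine (@reflection_affine _ l) _ _ _ (@reflection_cont _ l) Cu.
- by move=> x Ox; rewrite (laplacian_reflection oO Ox Cu) Lu.
- by rewrite (energy_reflection l oO (Ck_onW Cu)).
- move=> p n /nT np Dp; have [w [Cw w0]] := Du _ _ np Dp.
  exists (w \o T); split=> //.
  by have := C2_extension_reflection l Cw; rewrite /T reflectionK.
- move=> p n /nT np Dp; have [w [Cw w0]] := Nu _ _ np Dp.
  exists (w \o T); split.
    by have := C2_extension_reflection l Cw; rewrite /T reflectionK.
  exact: etrans (derive_comp_affine (@reflection_affine _ l) w n p) w0.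
Unshelve. all: by end_near. Qed.

Lemma mixed_solution_sub A B D D' N N' u : open A -> open B -> B `<=` A ->
  D' `<=` D -> N' `<=` N ->
  (forall p, D' p \/ N' p -> \forall x \near p, A x <-> B x) ->
  mixed_solution A D N lam u -> mixed_solution B D' N' lam u.
Proof.
move=> oA oB BA DD NN AB [Cu Lu Eu Du Nu]; split.
- exact: Ck_onS Cu.
- by move=> x /BA; exact: Lu.
- by apply: le_lt_trans Eu; apply: energy_subset => //; exact: Ck_onW.
- apply: (dirichlet_near (A := A) (u := u)); last exact: dirichletS Du.
  by move=> p Dp; apply: filterS (AB p (or_introl Dp)).
- apply: (neumann_near (A := A) (u := u)); last exact: neumannS Nu.
  by move=> p Dp; apply: filterS (AB p (or_intror Dp)).
Qed.

End MixedProblem.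

(** * Folding and unfolding *)

Section HalfDiscNormal.
Context {R : realType}.
Implicit Types (l : line R) (p q n : R * R) (A B K : set (R * R)) (u v w f g : R * R -> R).
Local Opaque derive e1 e2.

Lemma is_derive_affine (V : normedModType R) (f d : V -> R) (v x : V) :
  (forall h (v x : V), f (h *: v + x) = h * d v + f x) -> is_derive x v f (d v).
Proof.
move=> fd.
have H : \forall h \near (0 : R)^', h^-1 *: ((f \o shift x) (h *: v) - f x) = d v.
  near=> h; rewrite /= fd addrK [LHS]mulrA mulVf ?mul1r//.
  by near: h; exact: nbhs_dnbhs_neq.
split; first by apply: is_cvg_near_cst; exact: H.
by apply: lim_near_cst.
Unshelve. all: by end_near. Qed.

Lemma Ck_on_affine (V : normedModType R) k (A : set V) (f d : V -> R) : continuous f ->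
  (forall h (v x : V), f (h *: v + x) = h * d v + f x) -> Ck_on k A f.
Proof.
elim: k f d => [|k IH] f d cf fd; first by split=> // p _; exact: cf.
split=> [p _|v]; first exact: cf.
have D x := is_derive_affine v x fd.
split=> [p _|]; first by case: (D p).
have -> : 'D_v f = (fun _ => d v) by apply/funext => x; case: (D x).
by apply: (IH _ (fun _ => 0)) => [x|h w x]; [exact: cvg_cst|rewrite mulr0 add0r].
Qed.

Lemma half_disc_normal l K p : dot (normal l) (normal l) = 1 -> points l p ->
  (\forall x \near p, K x <-> 0 < side l x) -> outer_normal K p (- normal l).
Proof.
move=> n1 lp Kp.
have aff h (v x : R * R) : - side l (h *: v + x) = h * (- dot (normal l) v) + - side l x.
  by rewrite side_affine; ring.
exists (interior [set x | K x <-> 0 < side l x]), (fun x => - side l x), 1; split.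
- by split => //; exact: open_interior.
- move=> k; apply: (Ck_on_affine _ _ _ aff) => x.
  by apply: cvgN; exact: side_cont.
- by move=> x /interior_subset /= [H1 H2]; rewrite oppr_lt0; split.
- by rewrite lp oppr0.
split=> //; first by rewrite dotNr dotC dotNr opprK.
move=> v; have [_ ->] := is_derive_affine v p aff.
by rewrite mul1r [RHS]dotC dotNr dotC.
Qed.

(* On [l] a defining function is nonnegative and vanishes at [p], so its tangential
   derivative vanishes. *)
Lemma normal_half_disc l K p n : dot (normal l) (normal l) = 1 -> points l p ->
  (\forall x \near p, K x <-> 0 < side l x) -> outer_normal K p n ->
  n = dot (normal l) n *: normal l.
Proof.
move=> n1 lp Kp [U [phi [c [Up sphi UK p0 [nn c0 dphi]]]]].
set t := perp (normal l).
have [e e0 He] := near_along t (filterI (open_nbhs_nbhs Up) Kp).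
have [oU Up'] := Up.
have inU s : s \in `](- e), e[ -> U (p + s *: t) /\ (K (p + s *: t) <-> 0 < side l (p + s *: t)).
  by rewrite in_itv /= => se; apply: He; rewrite ler_norml; move: se => /andP[? ?]; rewrite !ltW.
have ds s : s \in `](- e), e[ -> is_derive s 1 (fun s => phi (p + s *: t)) ('D_t phi (p + s *: t)).
  move=> /inU[Us _]; apply: is_derive_along; exact: Ck_on_derivable (sphi 1%N) Us.
have e00 : (0 : R) \in `](- e), e[ by rewrite in_itv /= oppr_lt0 e0.
have ee : - e <= e by rewrite ge0_cp// ltW.
have min s : s \in `](- e), e[ -> phi (p + 0 *: t) <= phi (p + s *: t).
  move=> /inU[Us Ks]; rewrite scale0r addr0 p0 leNgt; apply/negP => /(UK _ Us) /Ks.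
  by rewrite addrC side_affine dot_perp mulr0 add0r lp ltxx.
have [_ D1] := derive1_at_min ee (fun s hs => let: DeriveDef d _ := ds s hs in d) e00 min.
have [_ D2] := ds 0 e00.
have : 'D_t phi p = 0.
  have -> : p = p + 0 *: t by rewrite scale0r addr0.
  by apply: etrans (esym D2) D1.
rewrite dphi => /eqP; rewrite mulf_eq0 gt_eqF//= => /eqP nt.
by rewrite {1}(perp_frame n n1) -/t (dotC t) nt scale0r addr0.
Qed.

Lemma closure_eq_continuous A p f g : closure A p ->
  {for p, continuous f} -> {for p, continuous g} ->
  (\forall x \near p, A x -> f x = g x) -> f p = g p.
Proof.
move=> cA cf cg fg; apply/eqP; rewrite -subr_eq0 -normr_le0.
apply/ler_addgt0Pl => e e0; rewrite addr0.
have e2 : 0 < e / 2 by rewrite divr_gt0.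
have near2 (a b c : R) : `|a - c| <= e / 2 -> `|b - c| <= e / 2 -> `|a - b| <= e.
  by rewrite !ler_norml => /andP[? ?] /andP[? ?]; apply/andP; split; lra.
have [y [Ay [[H1 H2] H3]]] := closure_near cA (filterI (filterI
  ((cvgrPdist_le _ _).1 cf _ e2) ((cvgrPdist_le _ _).1 cg _ e2)) fg).
by apply: near2 H1 _; rewrite (H3 Ay).
Qed.

Lemma closure_eq_derive A U p f g n : open A -> closure A p -> open_nbhs p U ->
  Ck_on 1 U f -> Ck_on 1 U g -> (forall x, U x -> A x -> f x = g x) ->
  'D_n f p = 'D_n g p.
Proof.
move=> oA cA [oU Up] Cf Cg fg.
have UA : open (U `&` A) by exact: openI.
apply: (closure_eq_continuous (f := 'D_n f) (g := 'D_n g) cA).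
- exact: Ck_on_cont (Ck_on_derive n Cf) Up.
- exact: Ck_on_cont (Ck_on_derive n Cg) Up.
near=> x => Ax; apply: near_eq_derive.
have Ux : U x by near: x; exact: open_nbhs_nbhs.
have : \forall y \near x, (U `&` A) y by apply: open_nbhs_nbhs.
by apply: filterS => y [Uy Ay]; exact: fg.
Unshelve. all: by end_near. Qed.

(** Both extensions agree on [A] near [p], hence so do their derivatives there, and continuity
    carries this to [p]. A boundary condition known for some extension thus holds for any given
    one. *)
Lemma C2_extension_unique A p u w z : open A -> closure A p ->
  C2_extension A p u w -> C2_extension A p u z ->
  w p = z p /\ forall n, 'D_n w p = 'D_n z p.
Proof.
move=> oA cA [U [[oU Up] Cw wu]] [V [[oV Vp] Cz zv]].
have UV : open_nbhs p (U `&` V) by split=> //; exact: openI.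
have wz x : (U `&` V) x -> A x -> w x = z x by move=> [Ux Vx] Ax; rewrite wu// zv.
split=> [|n].
  apply: (closure_eq_continuous cA (Ck_on_cont Cw Up) (Ck_on_cont Cz Vp)).
  by have := open_nbhs_nbhs UV; apply: filterS.
apply: (closure_eq_derive n oA cA UV) => //.
  by apply: Ck_onS (Ck_onW Cw) => x [].
by apply: Ck_onS (Ck_onW Cz) => x [].
Qed.

Lemma laplacian_cont U p f : Ck_on 2 U f -> U p -> {for p, continuous (laplacian f)}.
Proof.
move=> Cf Up.
have c n : {for p, continuous ('D_n ('D_n f))}.
  exact: Ck_on_cont (Ck_on_derive n (Ck_on_derive n Cf)) Up.
exact: (cvgD (c e1) (c e2)).
Qed.

(** The equation passes to the boundary by continuity of the second derivatives. On the axis it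
    makes Laplacians agree as soon as values do. *)
Lemma closure_helmholtz (lam : R) A U p f g : open A -> closure A p -> open_nbhs p U ->
  Ck_on 2 U g -> (forall x, U x -> A x -> g x = f x) ->
  (forall x, A x -> - laplacian f x = lam * f x) -> - laplacian g p = lam * g p.
Proof.
move=> oA cA [oU Up] Cg gf Lf.
have UA : open (U `&` A) by exact: openI.
have cg : {for p, continuous (fun x => lam * g x)}.
  by apply: cvgM; [exact: cvg_cst|exact: Ck_on_cont Cg Up].
have cl : {for p, continuous (fun x => - laplacian g x)}.
  by apply: cvgN; exact: laplacian_cont Cg Up.
apply: (closure_eq_continuous cA cl cg); near=> x => Ax.
have Ux : U x by near: x; exact: open_nbhs_nbhs.
have E : laplacian g x = laplacian f x.
  by apply: (eq_laplacian UA) => // y /set_mem[Uy Ay]; exact: gf.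
have K (a b c d : R) : a = b -> c = d -> - b = lam * d -> - a = lam * c by move=> -> ->.
exact: K E (gf x Ux Ax) (Lf x Ax).
Unshelve. all: by end_near. Qed.

End HalfDiscNormal.

Section Folding.
Context {R : realType}.
Variable lam : R.
Implicit Types (l : line R) (p q n : R * R) (A B D N K : set (R * R)) (u v w f g : R * R -> R).
Local Opaque derive e1 e2.

(* The pair of restrictions to [K] of a function on the doubled domain and of its
   reflection: [al] lies on the axis, [be] on the other line. *)
Definition folded K D N (al be : set (R * R)) f g : Prop :=
  [/\ mixed_solution K D (N `|` be) lam f, mixed_solution K (D `|` be) N lam g,
      dirichlet K al (fun x => f x - g x) & neumann K al (fun x => f x + g x)].

Lemma folded_transplant K D N al be f g : open K -> folded K D N al be f g ->
  folded K D N be al (fun x => f x + g x) (fun x => f x - g x).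
Proof.
move=> oK [Sf Sg dm np].
have [Cf Lf Ef Df Nf] := Sf; have [Cg Lg Eg Dg Ng] := Sg.
have Sf' : mixed_solution K D N lam f.
  by split=> //; apply: neumannS Nf => x; left.
have Sg' : mixed_solution K D N lam g.
  by split=> //; apply: dirichletS Dg => x; left.
have Sp : mixed_solution K D N lam (fun x => f x + g x).
  rewrite (_ : (fun x => _) = fun x => 1 * f x + 1 * g x).
    exact: mixed_solution_comb.
  by apply/funext => x; rewrite !mul1r.
have Sm : mixed_solution K D N lam (fun x => f x - g x).
  rewrite (_ : (fun x => _) = fun x => 1 * f x + (-1) * g x).
    exact: mixed_solution_comb.
  by apply/funext => x; rewrite mul1r mulN1r.
split.
- by have [C L E d n] := Sp; split=> //; apply: neumannU.
- by have [C L E d n] := Sm; split=> //; apply: dirichletU.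
(* The difference of the new branches is [2 g], which is Dirichlet on [be]; their sum, below, is
   [2 f], which is Neumann there. *)
- rewrite (_ : (fun x => _) = fun x => 2 * g x + 0 * g x).
    have [_ _ _ d _] := mixed_solution_comb 2 0 oK Sg Sg.
    by apply: dirichletS d => x; right.
  by apply/funext => x; ring.
- rewrite (_ : (fun x => _) = fun x => 2 * f x + 0 * f x).
    have [_ _ _ _ n] := mixed_solution_comb 2 0 oK Sf Sf.
    by apply: neumannS n => x; right.
  by apply/funext => x; ring.
Qed.

Section OneLine.
Variables (l : line R) (K D N be : set (R * R)).
Hypothesis n1 : dot (normal l) (normal l) = 1.
Hypotheses (oK : open K) (regK : interior (closure K) `<=` K).
Hypothesis Kside : K `<=` [set y | 0 < side l y].
Hypothesis Dside : D `<=` [set y | 0 < side l y].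
Hypothesis Nside : N `<=` [set y | 0 < side l y].
Hypothesis be_side : be `<=` [set y | 0 < side l y].
Local Notation T := (reflection l).
Local Notation Om := (doubled l K).
Local Notation al := (straight l K).
Local Notation DD := (D `|` T @` D `|` T @` be).
Local Notation NN := (N `|` T @` N `|` be).

Lemma doubled_near p : 0 < side l p -> \forall x \near p, Om x <-> K x.
Proof.
by move=> /near_side_gt0; apply: filterS => x; exact: doubled_pos.
Qed.

Lemma preimage_doubled : T @^-1` Om = Om.
Proof. by apply/seteqP; split=> x /(doubled_sym l K). Qed.

Lemma sub_doubled : K `<=` Om.
Proof. by move=> x Kx; apply/(doubled_pos oK regK Kside) => //; exact: Kside. Qed.

(** The axis conditions come from parity: [u - u \o T] is odd and [u + u \o T] even under [T], and
    both are C^2 across the axis. *)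
Lemma folded_restriction u : mixed_solution Om DD NN lam u ->
  folded K D N al be u (u \o T).
Proof.
move=> Su; have [Cu Lu Eu Du Nu] := Su.
have STu := mixed_solution_reflection l (@open_doubled _ l K) Su.
rewrite preimage_doubled in STu; have [CTu _ _ _ _] := STu.
have C2m : Ck_on 2 Om (fun x => u x - (u \o T) x) := Ck_onB (@open_doubled _ l K) Cu CTu.
have C2p : Ck_on 2 Om (fun x => u x + (u \o T) x) := Ck_onD (@open_doubled _ l K) Cu CTu.
have near_axis p : al p -> Om p /\ T p = p.
  move=> ap; have lp : points l p := straight_points ap.
  split; last exact: reflection_point.
  exact/(doubled_line oK regK Kside lp).
have ext p w : Om p -> Ck_on 2 Om w -> C2_extension K p w w.
  move=> Op Cw; apply: (C2_extension_near (A := Om) (u := w)).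
    by near=> x => Kx; split=> //; exact: sub_doubled.
  exact: C2_extension_self (@open_doubled _ l K) Op Cw.
split.
- apply: mixed_solution_sub Su => //.
  + exact: (@open_doubled _ l K).
  + exact: sub_doubled.
  + by move=> x Dx; left; left.
  + by move=> x [Nx|bx]; [left; left|right].
  + by move=> p pD; apply: doubled_near; case: pD => [/Dside|[/Nside|/be_side]].
- apply: mixed_solution_sub STu => //.
  + exact: (@open_doubled _ l K).
  + exact: sub_doubled.
  + by move=> x [Dx|bx]; [left; right; exists x|right; exists x].
  + by move=> x Nx; left; right; exists x.
  + by move=> p pD; apply: doubled_near; case: pD => [[/Dside|/be_side]|/Nside].
- move=> p n np ap; have [Op Tp] := near_axis p ap.
  exists (fun x => u x - (u \o T) x); split; first exact: (ext p _ Op C2m).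
  have : u p - u (T p) = 0 by rewrite Tp subrr.
  exact.
- move=> p n np ap; have [Op Tp] := near_axis p ap.
  exists (fun x => u x + (u \o T) x); split; first exact: (ext p _ Op C2p).
  have lp : points l p := straight_points ap.
  (* The condition concerns an arbitrary outer normal [n]; the half-disc forces it along [normal l],
     where the linear part of [T] is a change of sign. *)
  have nE := normal_half_disc n1 lp (straight_near oK Kside ap) np.
  have Ln : linear_reflection l n = - n by rewrite nE linear_reflection_normal.
  have E1 := derive_comp_affine (@reflection_affine _ l) u n p.
  rewrite Tp Ln in E1.
  have E2 := derive_dirN n Op (Ck_onW Cu).
  have d1 : derivable u p n := Ck_on_derivable Cu Op.
  have d2 : derivable (u \o T) p n := Ck_on_derivable CTu Op.
  have [_ E3] := is_deriveD (derivableP d1) (derivableP d2).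
  apply: etrans E3 _.
  have K0 (a b c : R) : b = c -> c = - a -> a + b = 0 by move=> -> ->; rewrite subrr.
  exact: K0 E1 E2.
Unshelve. all: by end_near. Qed.

(* Boundary value on [l] of a function on [K]; [0] where there is no C^2 extension. *)
Definition trace f p : R := xget 0 [set w p | w in C2_extension K p f].

Lemma traceE f w p : closure K p -> C2_extension K p f w -> trace f p = w p.
Proof.
move=> cK fw; rewrite /trace; case: xgetP => [_ -> [z fz <-]|/(_ (w p))[]]; last by exists w.
by have [] := C2_extension_unique oK cK fz fw.
Qed.

(** On the axis neither branch is meaningful, since values outside [K] are arbitrary; the common
    boundary value is used there. *)
Definition unfold f g x : R :=
  if 0 < side l x then f x else if side l x < 0 then g (T x) else trace f x.

Lemma unfold_pos f g x : 0 < side l x -> unfold f g x = f x.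
Proof. by rewrite /unfold => ->. Qed.

Lemma unfold_neg f g x : side l x < 0 -> unfold f g x = g (T x).
Proof. by move=> sx; rewrite /unfold sx ifF//; apply/negbTE; rewrite -leNgt ltW. Qed.

Lemma unfold_line f g x : points l x -> unfold f g x = trace f x.
Proof. by rewrite /unfold => ->; rewrite ltxx. Qed.

(** Half the sum and half the difference of the extensions [w2] of [f + g] and [w1] of [f - g]
    extend [f] and [g] across the axis as [F] and [G]. It remains to glue [F] to [G \o T]. *)
Lemma unfold_near_axis f g p : folded K D N al be f g -> al p ->
  Ck_on 2 [set p] (unfold f g).
Proof.
move=> [[Cf Lf Ef Df Nf] [Cg Lg Eg Dg Ng] dm np] ap.
have lp : points l p := straight_points ap.
have Kp := straight_near oK Kside ap.
have bp : closure K p by case: (straight_boundary ap).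
have [w1 [[U1 [[oU1 U1p] Cw1 w1E]] _]] := dm p _ (half_disc_normal n1 lp Kp) ap.
have [w2 [[U2 [[oU2 U2p] Cw2 w2E]] _]] := np p _ (half_disc_normal n1 lp Kp) ap.
pose V := (U1 `&` U2) `&` interior [set x | K x <-> 0 < side l x].
have oV : open V by apply: openI; [exact: openI|exact: open_interior].
(* The neighbourhood is made symmetric so that [G \o T] is C^2 on all of it. *)
pose U := V `&` (T @^-1` V).
have oU : open U.
  by apply: openI => //; apply: open_comp => // x _; exact: reflection_cont.
have Vp : V p by split.
have Up : U p by split=> //; rewrite /preimage /= reflection_point.
have UT x : U x -> U (T x) by move=> [V1 V2]; split=> //; rewrite /preimage /= reflectionK.
have C1 : Ck_on 2 U w1 by apply: Ck_onS Cw1 => x [[[]]].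
have C2 : Ck_on 2 U w2 by apply: Ck_onS Cw2 => x [[[]]].
pose F x := 2^-1 * w2 x + 2^-1 * w1 x.
pose G x := 2^-1 * w2 x + (- 2^-1) * w1 x.
have half : (2^-1 + 2^-1 : R) = 1 by rewrite [RHS](splitr 1) !div1r.
have CF : Ck_on 2 U F := Ck_onD oU (Ck_onZ _ oU C2) (Ck_onZ _ oU C1).
have CG : Ck_on 2 U G := Ck_onD oU (Ck_onZ _ oU C2) (Ck_onZ _ oU C1).
have UK x : U x -> \forall y \near x, K y <-> 0 < side l y by move=> [[_]].
have FE x : U x -> K x -> F x = f x.
  move=> [[[? ?] _] _] Kx; rewrite /F w1E// w2E//.
  transitivity ((2^-1 + 2^-1) * f x); first by ring.
  by rewrite half mul1r.
have GE x : U x -> K x -> G x = g x.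
  move=> [[[? ?] _] _] Kx; rewrite /G w1E// w2E//.
  transitivity ((2^-1 + 2^-1) * g x); first by ring.
  by rewrite half mul1r.
have axis q : U q -> points l q -> [/\ al q, closure K q & T q = q].
  move=> Uq lq; have aq : al q := half_disc_straight oK Kside lq (UK q Uq).
  by split=> //; [case: (straight_boundary aq)|exact: reflection_point].
have CGT : Ck_on 2 U (G \o T).
  have -> : U = T @^-1` U by apply/seteqP; split=> x; [exact: UT|move=> /UT; rewrite reflectionK].
  exact: Ck_on_comp_affine (@reflection_affine _ l) _ _ _ (@reflection_cont _ l) CG.
have ext1 q : U q -> C2_extension K q (fun x => f x - g x) w1.
  by move=> [[[? ?] ?] ?]; exists U1.
have ext2 q : U q -> C2_extension K q (fun x => f x + g x) w2.
  by move=> [[[? ?] ?] ?]; exists U2.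
(* Gluing needs the axis conditions at every axis point of [U]. Away from [p] they are given for
   other extensions, and uniqueness transfers them to [w1] and [w2]. *)
have w10 q : U q -> points l q -> w1 q = 0.
  move=> Uq lq; have [aq cq _] := axis q Uq lq.
  have [z [Cz z0]] := dm q _ (half_disc_normal n1 lq (UK q Uq)) aq.
  by have [-> _] := C2_extension_unique oK cq (ext1 q Uq) Cz.
have w20 q : U q -> points l q -> 'D_(- normal l) w2 q = 0.
  move=> Uq lq; have [aq cq _] := axis q Uq lq.
  have [z [Cz z0]] := np q _ (half_disc_normal n1 lq (UK q Uq)) aq.
  have [_ E] := C2_extension_unique oK cq (ext2 q Uq) Cz.
  exact: etrans (E _) z0.
(* Vanishing of [w1] on the axis gives [F = G] there. Vanishing of the normal derivative of [w2]
   makes those of [F] and [G] opposite, and [T] reverses the sign once more. The Laplacians agree by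
   the equation. *)
have glue : Ck_on 2 U (fun x => if 0 < side l x then F x else (G \o T) x).
  apply: (glue_C2 n1 oU CF CGT) => q Uq lq; have [aq cq Tq] := axis q Uq lq.
  have FG : F q = G q by rewrite /F /G w10// !mulr0.
  split.
  - by rewrite /= Tq.
  - have E1 := derive_comb_fun (normal l) 2^-1 2^-1 oU Uq (Ck_onW C2) (Ck_onW C1).
    have E2 := derive_comp_affine (@reflection_affine _ l) G (normal l) q.
    rewrite Tq -{2}(scale1r (normal l)) linear_reflection_normal scale1r in E2.
    have E3 := derive_comb_fun (- normal l) 2^-1 (- 2^-1) oU Uq (Ck_onW C2) (Ck_onW C1).
    have E4 := derive_dirN (normal l) Uq (Ck_onW C1).
    have E5 := derive_dirN (normal l) Uq (Ck_onW C2).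
    have E6 := w20 q Uq lq.
    have alg (a b c d x y z t : R) : x = a * c + a * d -> y = a * z + (- a) * t ->
        t = - d -> z = - c -> z = 0 -> x = y.
      move=> -> -> -> -> c0; have -> : c = 0 by apply: oppr_inj; rewrite c0 oppr0.
      by ring.
    exact: etrans (alg _ 0 _ _ _ _ _ _ E1 E3 E4 E5 E6) (esym E2).
  - have EG := laplacian_reflection (l := l) (x := q) oU (UT q Uq) CG.
    rewrite Tq in EG.
    have H1 := closure_helmholtz oK cq (conj oU Uq) CF FE Lf.
    have H2 := closure_helmholtz oK cq (conj oU Uq) CG GE Lg.
    have alg (a b c d e : R) : - a = lam * c -> - b = lam * d -> c = d -> e = b -> a = e.
      by move=> H3 H4 cd ->; apply: oppr_inj; rewrite H3 H4 cd.
    exact: alg H1 H2 FG EG.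
apply: Ck_on_nbhs; exists U; split; first by split.
apply: (eq_Ck_on oU _ glue) => x /set_mem Ux.
have [Vx VTx] := Ux.
have [sx|sx|sx] := ltrgt0P (side l x).
- by rewrite unfold_pos// FE//; apply/(nbhs_singleton (UK x Ux)).
- rewrite unfold_neg//= GE//; first exact: UT.
  by apply/(nbhs_singleton (UK _ (UT x Ux))); rewrite side_reflection oppr_gt0.
- have [ax cx Tx] := axis x Ux sx.
  rewrite unfold_line// /= Tx (@traceE f F)//.
    by rewrite /F /G w10// !mulr0.
  by exists U; split.
Qed.

Lemma unfold_C2 f g : folded K D N al be f g -> Ck_on 2 Om (unfold f g).
Proof.
move=> H; apply: Ck_on_pointwise => p Op.
have [[Cf _ _ _ _] [Cg _ _ _ _] _ _] := H.
have [sp|sp|sp] := ltrgt0P (side l p).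
- have Kp : K p by apply/(doubled_pos oK regK Kside sp).
  apply: (near_eq_Ck_on (f := f)); last by apply: Ck_onS Cf => _ ->.
  by apply: filterS (near_side_gt0 sp) => x sx; rewrite unfold_pos.
- have Kp : K (T p) by apply/(doubled_neg oK regK Kside sp).
  apply: (near_eq_Ck_on (f := g \o T)).
    by apply: filterS (near_side_lt0 sp) => x sx; rewrite unfold_neg.
  have := Ck_on_comp_affine (@reflection_affine _ l) (@reflection_cont _ l) Cg.
  by apply: Ck_onS => _ ->.
- by apply: unfold_near_axis H _; apply/(doubled_line oK regK Kside sp).
Qed.

Lemma unfold_solution f g : folded K D N al be f g -> mixed_solution Om DD NN lam (unfold f g).
Proof.
move=> H; have C2v := unfold_C2 H.
have [[Cf Lf Ef Df Nf] Sg dm np] := H.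
have [CgT LgT EgT DgT NgT] := mixed_solution_reflection l oK Sg.
have oTK : open (T @^-1` K) by apply: open_comp => // x _; exact: reflection_cont.
have vf : {in K, f =1 unfold f g} by move=> x /set_mem /Kside sx; rewrite unfold_pos.
have TKneg x : (T @^-1` K) x -> side l x < 0.
  by move=> /Kside /=; rewrite side_reflection oppr_gt0.
have vg : {in T @^-1` K, g \o T =1 unfold f g}.
  by move=> x /set_mem /TKneg sx; rewrite unfold_neg.
have nearK p : 0 < side l p -> \forall x \near p, (K x <-> Om x) /\ (Om x -> f x = unfold f g x).
  move=> /near_side_gt0; apply: filterS => x sx; split.
    by apply: iff_sym; exact: doubled_pos.
  by rewrite unfold_pos.
have nearTK p : side l p < 0 ->
    \forall x \near p, (K (T x) <-> Om x) /\ (Om x -> (g \o T) x = unfold f g x).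
  move=> /near_side_lt0; apply: filterS => x sx; split.
    by apply: iff_sym; exact: doubled_neg.
  by rewrite unfold_neg.
have negT A p : A `<=` [set y | 0 < side l y] -> A (T p) -> side l p < 0.
  by move=> As /As /=; rewrite side_reflection oppr_gt0.
split.
- exact: C2v.
- move=> p Op; have [sp|sp|sp] := ltrgt0P (side l p).
  + have Kp : K p by apply/(doubled_pos oK regK Kside sp).
    by rewrite -(eq_laplacian oK Kp vf) unfold_pos// Lf.
  + have Kp : K (T p) by apply/(doubled_neg oK regK Kside sp).
    by rewrite -(eq_laplacian oTK Kp vg) unfold_neg// LgT.
  + have ap : al p by apply/(doubled_line oK regK Kside sp).
    have cp : closure K p by case: (straight_boundary ap).
    (* On the axis the equation is inherited from [K] by continuity, the unfolded function being
       already known to be C^2 there. *)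
    apply: (closure_helmholtz oK cp (conj (@open_doubled _ l K) Op) C2v _ Lf).
    by move=> x _ Kx; rewrite vf// inE.
(* Off the null set [points l] the energy is the sum of those of the two branches, each of them
   finite. *)
- have OmE : Om `\` points l = K `|` T @^-1` K.
    apply/seteqP; split=> x.
      move=> [Ox /eqP]; rewrite neq_lt => /orP[sx|sx].
        by right; apply/(doubled_neg oK regK Kside sx).
      by left; apply/(doubled_pos oK regK Kside sx).
    move=> [Kx|Kx]; split.
    - exact: sub_doubled.
    - by move=> lx; have := Kside Kx; rewrite /= lx ltxx.
    - by rewrite -preimage_doubled; exact: sub_doubled.
    - by move=> lx; have := TKneg x Kx; rewrite lx ltxx.
  have disj : K `&` T @^-1` K = set0.
    apply/seteqP; split=> x // [/Kside sx /TKneg]; rewrite ltNge ltW//.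
  rewrite (energy_null_split (@open_doubled _ l K) oK oTK (Ck_onW C2v) (measurable_points l)
    (measure_line0 l) OmE disj) -(eq_energy oK vf) -(eq_energy oTK vg).
  exact: (lte_add_pinfty Ef EgT).
- rewrite -setUA; apply: dirichletU.
    by apply: dirichlet_near Df => p /Dside; exact: nearK.
  rewrite -image_setU image_reflection.
  apply: dirichlet_near DgT => p Dp; apply: nearTK; apply: negT Dp.
  by move=> x [/Dside|/be_side].
- rewrite setUAC; apply: neumannU.
    by apply: neumann_near Nf => p [/Nside|/be_side]; exact: nearK.
  rewrite image_reflection.
  by apply: neumann_near NgT => p Np; apply: nearTK; exact: negT Np.
Qed.

End OneLine.
End Folding.

(** * Transplantation *)

Section Transplantation.
Context {R : realType}.
Implicit Types (l a b : line R) (p q x y : R * R) (A B D N K Om : set (R * R)).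

(** If [p] were on [a], the boundary of [K] would continue along [b] in both directions from [p]
    while staying on the nonnegative side of [a], forcing [b] parallel to [a]. The hypothesis on
    common points excludes coinciding lines and allows distinct parallel ones. *)
Lemma straight_off a b K p : open K ->
  K `<=` [set y | 0 < side a y] -> K `<=` [set y | 0 < side b y] ->
  (forall q, points a q -> points b q -> ~ parallel a b) ->
  straight b K p -> 0 < side a p.
Proof.
move=> oK Ka Kb nab bp.
have ge0 q : straight b K q -> 0 <= side a q.
  by move=> /straight_boundary[cq _]; exact: closure_side Ka cq.
have := ge0 p bp; rewrite le_eqVlt => /orP[/eqP /esym ap|//]; exfalso.
have pb : points b p := straight_points bp.
have [e e0 He] := near_along (perp (normal b)) (straight_nbhs oK Kb bp).
have side_t s : `|s| <= e -> 0 <= s * dot (normal a) (perp (normal b)).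
  move=> se; have := ge0 (p + s *: perp (normal b)).
  rewrite addrC side_affine ap addr0; apply; rewrite addrC; apply: He => //.
  by rewrite addrC /points /= side_affine dot_perp mulr0 add0r.
have H1 := side_t e; have H2 := side_t (- e).
move: H1 H2; rewrite normrN gtr0_norm// lexx mulNr oppr_ge0 => /(_ isT) h1 /(_ isT) h2.
have /eqP : e * dot (normal a) (perp (normal b)) = 0.
  by apply/eqP; rewrite eq_le h1 h2.
rewrite mulf_eq0 gt_eqF//= => /eqP H.
apply: (nab p ap pb); rewrite /parallel; move: H; rewrite /dot /perp /= => H.
by rewrite -oppr0 -H; ring.
Qed.

Lemma sigma_DN_le Om Om' D D' N N' (Phi : (R * R -> R) -> R * R -> R) (lam : R) :
  (forall u, mixed_solution Om D N lam u -> mixed_solution Om' D' N' lam (Phi u)) ->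
  (forall m (f : 'I_m -> R * R -> R), (forall i, mixed_solution Om D N lam (f i)) ->
     lin_indep_on Om f -> lin_indep_on Om' (fun i => Phi (f i))) ->
  (sigma_DN Om D N lam <= sigma_DN Om' D' N' lam)%E.
Proof.
move=> H1 H2; apply: le_ereal_sup => _ [m [f [fS fI]] <-]; exists m => //.
by exists (fun i => Phi (f i)); split; [move=> i; exact: H1|exact: H2].
Qed.

(** One inequality, applied also to the reflected problem, suffices because the reflection is an
    involution. *)
Lemma sigma_DN_reflection l Om D N : open Om ->
  sigma_DN (reflection l @^-1` Om) (reflection l @^-1` D) (reflection l @^-1` N) =
  sigma_DN Om D N.
Proof.
have H A D' N' (lam : R) : open A -> (sigma_DN A D' N' lam <=
    sigma_DN (reflection l @^-1` A) (reflection l @^-1` D') (reflection l @^-1` N') lam)%E.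
  move=> oA; apply: (@sigma_DN_le _ _ _ _ _ _ (fun u => u \o reflection l)).
    by move=> u; exact: mixed_solution_reflection.
  move=> m f _ fI c cf; apply: fI => x Ax.
  have := cf (reflection l x); rewrite /preimage /= reflectionK; exact.
move=> oA; apply/funext => lam; apply/eqP; rewrite eq_le H// andbT.
have rK B : reflection l @^-1` (reflection l @^-1` B) = B.
  by apply/seteqP; split=> x; rewrite /preimage /= reflectionK.
have oA' : open (reflection l @^-1` Om).
  by apply: open_comp => // x _; exact: reflection_cont.
by have := H _ (reflection l @^-1` D) (reflection l @^-1` N) lam oA'; rewrite !rK.
Qed.

Section TwoLines.
Variables (a b : line R) (K D N : set (R * R)).
Hypotheses (na : dot (normal a) (normal a) = 1) (nb : dot (normal b) (normal b) = 1).
Hypotheses (oK : open K) (regK : interior (closure K) `<=` K).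
Hypotheses (Ka : K `<=` [set y | 0 < side a y]) (Kb : K `<=` [set y | 0 < side b y]).
Hypotheses (Da : D `<=` [set y | 0 < side a y]) (Db : D `<=` [set y | 0 < side b y]).
Hypotheses (Na : N `<=` [set y | 0 < side a y]) (Nb : N `<=` [set y | 0 < side b y]).
Hypothesis nab : forall q, points a q -> points b q -> ~ parallel a b.

Definition doubled_dirichlet l be := D `|` reflection l @` D `|` reflection l @` be.

Definition doubled_neumann l be := N `|` reflection l @` N `|` be.

Lemma nba q : points b q -> points a q -> ~ parallel b a.
Proof.
move=> bq aq; move: (nab aq bq); rewrite /parallel => H E; apply: H.
by rewrite -oppr0 -E; ring.
Qed.

Definition transplant (u : R * R -> R) := unfold b K
  (fun x => u x + (u \o reflection a) x) (fun x => u x - (u \o reflection a) x).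

Lemma transplant_solution (lam : R) u :
  mixed_solution (doubled a K) (doubled_dirichlet a (straight b K))
    (doubled_neumann a (straight b K)) lam u ->
  mixed_solution (doubled b K) (doubled_dirichlet b (straight a K))
    (doubled_neumann b (straight a K)) lam (transplant u).
Proof.
have be_a : straight b K `<=` [set y | 0 < side a y].
  by move=> p; exact: straight_off.
have al_b : straight a K `<=` [set y | 0 < side b y].
  by move=> p; apply: straight_off => // q; exact: nba.
move=> /(folded_restriction na oK regK Ka Da Na be_a) /(folded_transplant oK).
exact: unfold_solution nb oK regK Kb Db Nb al_b _ _.
Qed.

(** Evaluating a vanishing combination at [x] in [K] and at its mirror image in [b] gives
    [S + S \o reflection a = 0] and [S - S \o reflection a = 0] at [x], so [S] vanishes off the axis
    [a], and on it by continuity. Only values off [b] are used, so the choice in [trace] does not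
    enter. *)
Lemma transplant_lin_indep (lam : R) m (f : 'I_m -> R * R -> R) :
  (forall i, mixed_solution (doubled a K) (doubled_dirichlet a (straight b K))
    (doubled_neumann a (straight b K)) lam (f i)) ->
  lin_indep_on (doubled a K) f -> lin_indep_on (doubled b K) (fun i => transplant (f i)).
Proof.
move=> fS fI c cf; apply: fI.
pose S x := \sum_(i < m) c i * f i x.
have S0 x : K x -> S x = 0 /\ S (reflection a x) = 0.
  move=> Kx; have sx := Kb Kx.
  have Ox : doubled b K x by exact: sub_doubled oK regK Kb x Kx.
  have OTx : doubled b K (reflection b x) by exact/(doubled_sym b K).
  have sTx : side b (reflection b x) < 0 by rewrite side_reflection oppr_lt0.
  have E1 : S x + S (reflection a x) = 0.
    rewrite -(cf x Ox) /S -big_split /=; apply: eq_bigr => i _.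
    by rewrite /transplant unfold_pos// mulrDr.
  have E2 : S x - S (reflection a x) = 0.
    rewrite -(cf _ OTx) /S -sumrB; apply: eq_bigr => i _.
    by rewrite /transplant unfold_neg// reflectionK /= mulrBr.
  by split; lra.
move=> y Oy; have [sy|sy|sy] := ltrgt0P (side a y).
- by have [] := S0 y ((doubled_pos oK regK Ka sy).1 Oy).
- by have [_] := S0 _ ((doubled_neg oK regK Ka sy).1 Oy); rewrite reflectionK.
have ay : straight a K y by exact: (doubled_line oK regK Ka sy).1.
have cy : closure K y by case: (straight_boundary ay).
apply: (closure_eq_continuous (f := S) (g := fun _ => 0) cy).
- have cfi i : {for y, continuous (f i)} by have [Ci _ _ _ _] := fS i; exact: Ck_on_cont Ci Oy.
  have -> : S = \sum_(i < m) (fun x => c i * f i x).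
    by apply/funext => x; rewrite /S fct_sumE.
  elim/big_ind : _ => [|g h cg ch|i _]; first exact: cvg_cst.
    exact: cvgD.
  by apply: cvgM; [exact: cvg_cst|exact: cfi].
- exact: cvg_cst.
- by near=> x => /S0[].
Unshelve. all: by end_near. Qed.

Lemma transplant_sigma_le (lam : R) :
  (sigma_DN (doubled a K) (doubled_dirichlet a (straight b K))
    (doubled_neumann a (straight b K)) lam <=
   sigma_DN (doubled b K) (doubled_dirichlet b (straight a K))
    (doubled_neumann b (straight a K)) lam)%E.
Proof.
apply: (@sigma_DN_le _ _ _ _ _ _ transplant); first exact: transplant_solution.
exact: transplant_lin_indep.
Qed.

End TwoLines.

(** The normal is rescaled to unit length and turned towards [K], as the one-line results assume;
    the data of the theorem depend only on the reflection and the point set. *)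
Lemma unit_line l K (s : bool) : K `<=` [set x | 0 < (-1) ^+ s * side l x] ->
  exists l', [/\ dot (normal l') (normal l') = 1, reflection l' = reflection l,
    points l' = points l, K `<=` [set x | 0 < side l' x] &
    exists2 c, c != 0 & normal l' = c *: normal l].
Proof.
move=> Ks; have d0 := dot_gt0 (normal_neq0 l); set d := dot _ _ in d0.
have sd0 : 0 < Num.sqrt d by rewrite sqrtr_gt0.
have c0 : (-1) ^+ s / Num.sqrt d != 0 by rewrite mulf_neq0// ?signr_eq0 ?invr_neq0// gt_eqF.
have c2 : ((-1) ^+ s / Num.sqrt d) ^+ 2 * d = 1.
  by rewrite exprMn sqrr_sign mul1r exprVn sqr_sqrtr ?ltW// mulVf// gt_eqF.
set c := _ / _ in c0 c2.
have n0 : c *: normal l != 0 by rewrite scaler_eq0 negb_or c0 normal_neq0.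
have sideE x : side (Line (c * offset l) n0) x = c * side l x.
  by rewrite /side /= dotC dotZr dotC mulrBr.
have nE : dot (c *: normal l) (c *: normal l) = 1.
  by rewrite dotZr dotC dotZr mulrA -expr2.
exists (Line (c * offset l) n0); split=> /=.
- exact: nE.
- apply/funext => x; rewrite /reflection sideE /= nE divr1 scalerA.
  congr (_ - _ *: _); apply: (mulIf (lt0r_neq0 d0)); rewrite divfK ?gt_eqF//.
  transitivity (2 * side l x * (c ^+ 2 * d)); first by ring.
  by rewrite c2 mulr1.
- apply/seteqP; split=> x; rewrite /points /= sideE; last by move=> ->; rewrite mulr0.
  by move=> /eqP; rewrite mulf_eq0 (negbTE c0) => /eqP.
- move=> x /Ks /= H; rewrite sideE /c mulrAC.
  by rewrite divr_gt0.
- by exists c.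
Qed.

Lemma parallel_side a b x y : parallel a b -> points b x -> points b y -> side a x = side a y.
Proof.
move=> ab bx byy; have d0 := dot_gt0 (normal_neq0 b).
have E : dot (normal a) x - dot (normal a) y = 0.
  apply: (mulIf (lt0r_neq0 d0)); rewrite mul0r.
  have bxy : dot (normal b) x - dot (normal b) y = 0.
    by move: bx byy; rewrite /points /side /=; lra.
  (* With [w = x - y] this splits [normal a] and [w] into components along and across [normal b];
     the cross component of [normal a] is zero for parallel lines. *)
  transitivity (dot (normal a) (normal b) * (dot (normal b) x - dot (normal b) y) +
    ((normal a).1 * (normal b).2 - (normal a).2 * (normal b).1) *
    ((x.1 - y.1) * (normal b).2 - (x.2 - y.2) * (normal b).1)).
    by rewrite /dot; ring.
  by rewrite bxy ab mulr0 mul0r addr0.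
by rewrite /side; lra.
Qed.

Lemma parallelC a b : parallel a b -> parallel b a.
Proof. by rewrite /parallel => E; rewrite -oppr0 -E; ring. Qed.

Lemma open_not_in_line l K k : open K -> K k -> ~ K `<=` points l.
Proof.
move=> oK Kk Kl; have [e e0 He] := near_along (normal l) (open_nbhs_nbhs (conj oK Kk)).
have ee : `|e| <= e by rewrite gtr0_norm.
have := Kl _ (He e ee); rewrite /points /= addrC side_affine (Kl k Kk) addr0 => /eqP.
by rewrite mulf_eq0 !gt_eqF// dot_gt0// normal_neq0.
Qed.

(** For parallel lines [side a] is constant on [b] and [side b] on [a]; the signs of these constants
    give [s] and [t]. They are nonzero, as otherwise the open set [K] would lie in a line, so the
    lines do not meet. *)
Lemma sector_of_lies_in a b K k : open K -> K k -> lies_in_sector a b K ->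
  exists s t : bool, [/\ K `<=` [set x | 0 < (-1) ^+ s * side a x],
    K `<=` [set x | 0 < (-1) ^+ t * side b x] &
    forall p, points a p -> points b p -> ~ parallel a b].
Proof.
move=> oK Kk [[ab Kbt]|[nab [s [t Kst]]]]; last first.
  by exists s, t; split=> // x /Kst[].
have [y0 [z0 [_ [ay0 bz0 _ _]]]] := Kbt k Kk.
have sideE x : K x -> exists t, [/\ 0 < t < 1, side a x = t * side a z0 &
    side b x = (1 - t) * side b y0].
  move=> /Kbt[y [z [t [ay bz t01 ->]]]]; exists t; split=> //.
    rewrite (parallel_side ab bz0 bz); move: ay; rewrite /points /side !dotDr !dotZr /=; nra.
  rewrite (parallel_side (parallelC ab) ay0 ay).
  by move: bz; rewrite /points /side !dotDr !dotZr /=; nra.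
have az0 : side a z0 != 0.
  apply/eqP => a0; apply: (open_not_in_line (l := a) oK Kk) => x /sideE[t [_ E _]].
  by rewrite /points /= E a0 mulr0.
have by0 : side b y0 != 0.
  apply/eqP => a0; apply: (open_not_in_line (l := b) oK Kk) => x /sideE[t [_ _ E]].
  by rewrite /points /= E a0 mulr0.
have sgn (z : R) : z != 0 -> 0 < (-1) ^+ (z < 0)%R * z.
  move=> z0'; have [zn|zp] := ltP z 0; first by rewrite expr1 mulN1r oppr_gt0.
  by rewrite expr0 mul1r lt_neqAle eq_sym z0'.
exists (side a z0 < 0), (side b y0 < 0); split=> [x|x|p ap bp _].
- move=> /sideE[t [/andP[t0 t1] E _]]; rewrite /= E mulrCA mulr_gt0// sgn//.
- move=> /sideE[t [/andP[t0 t1] _ E]]; rewrite /= E mulrCA mulr_gt0// ?subr_gt0// sgn//.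
- by move: az0; rewrite (parallel_side ab bz0 bp) ap eqxx.
Qed.

End Transplantation.

(* In the parts D1, N1, D2, N2 the closed sets daK and dbK are taken without
   their (finitely many) end points and isolated contact points. *)
Theorem theorem3p1 (R : realType) (a b : line R) (K D0 N0 : set (R * R)) :
  let Ta := reflection a in
  let Tb := reflection b in
  let daK := boundary K `&` points a in
  let dbK := boundary K `&` points b in
  let d0K := boundary K `\` (daK `|` dbK) in
  let daK' := relint (boundary K) daK in
  let dbK' := relint (boundary K) dbK in
  let Om1 := interior (closure (K `|` Ta @` K)) in
  let Om2 := interior (closure (K `|` Tb @` K)) in
  let D1 := D0 `|` Ta @` D0 `|` Ta @` dbK' in
  let N1 := N0 `|` Ta @` N0 `|` dbK' in
  let D2 := D0 `|` Tb @` D0 `|` daK' in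
  let N2 := N0 `|` Tb @` N0 `|` Tb @` daK' in
  bounded_set K -> open K -> piecewise_smooth_boundary K ->
  lies_in_sector a b K ->
  daK !=set0 -> dbK !=set0 ->
  finite_union_of_open_arcs D0 -> finite_union_of_open_arcs N0 ->
  D0 `<=` d0K -> N0 `<=` d0K -> D0 `&` N0 = set0 ->
  finite_set (d0K `\` (D0 `|` N0)) ->
  sigma_DN Om1 D1 N1 = sigma_DN Om2 D2 N2.
Proof.
move=> Ta Tb daK dbK d0K daK' dbK' Om1 Om2 D1 N1 D2 N2 _ oK psK sabK [q [[cq _] _]] _ _ _
  DK NK _ _.
(* Non-emptiness of [K], needed to orient the lines, comes from the boundary point on [a]. *)
have [k [Kk _]] := closure_near cq (filterT : \forall y \near q, True).
have regK := piecewise_smooth_regular oK psK.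
have [s [t [Ksa Ktb nab]]] := sector_of_lies_in oK Kk sabK.
have [a' [na ra pa Ka [ca ca0 nEa]]] := unit_line Ksa.
have [b' [nb rb pb Kb [cb cb0 nEb]]] := unit_line Ktb.
have nab' p : points a' p -> points b' p -> ~ parallel a' b'.
  rewrite pa pb => ap bp; move: (nab p ap bp); rewrite /parallel nEa nEb !coordE => H E.
  apply: H; apply/(mulfI ca0)/(mulfI cb0); rewrite !mulr0 -E; ring.
have pos (l : line R) A : K `<=` [set x | 0 < side l x] ->
    (forall x, A x -> boundary K x /\ ~ points l x) -> A `<=` [set x | 0 < side l x].
  move=> Kl Al x /Al[[cx _] lx]; rewrite /= lt_neqAle (closure_side Kl cx) andbT.
  by apply/negP => /eqP /esym.
have offa A : A `<=` d0K -> forall x, A x -> boundary K x /\ ~ points a' x.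
  by move=> AK x /AK[bx nx]; split=> //; rewrite pa => ax; apply: nx; left.
have offb A : A `<=` d0K -> forall x, A x -> boundary K x /\ ~ points b' x.
  by move=> AK x /AK[bx nx]; split=> //; rewrite pb => ax; apply: nx; right.
have Da := pos _ _ Ka (offa _ DK); have Db := pos _ _ Kb (offb _ DK).
have Na := pos _ _ Ka (offa _ NK); have Nb := pos _ _ Kb (offb _ NK).
have E1 : Om1 = doubled a' K by rewrite /Om1 /Ta -ra.
have E2 : Om2 = doubled b' K by rewrite /Om2 /Tb -rb.
have EA : daK' = straight a' K by rewrite /daK' /daK -pa.
have EB : dbK' = straight b' K by rewrite /dbK' /dbK -pb.
(* This moves the Dirichlet part from [daK'] to its mirror image, where [transplant] produces it. *)
rewrite -(sigma_DN_reflection b' D2 N2 (open_interior _ : open Om2)).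
have -> : reflection b' @^-1` Om2 = doubled b' K by rewrite E2 preimage_doubled.
have -> : reflection b' @^-1` D2 = doubled_dirichlet D0 b' (straight a' K).
  rewrite /doubled_dirichlet !image_reflection /D2 /Tb -rb image_reflection EA.
  rewrite !preimage_setU [_ `|` reflection b' @^-1` D0]setUC; congr (_ `|` _ `|` _).
  by apply/seteqP; split=> x; rewrite /preimage /= reflectionK.
have -> : reflection b' @^-1` N2 = doubled_neumann N0 b' (straight a' K).
  rewrite /doubled_neumann !image_reflection /N2 /Tb -rb !image_reflection EA.
  have rK B : reflection b' @^-1` (reflection b' @^-1` B) = B.
    by apply/seteqP; split=> x; rewrite /preimage /= reflectionK.
  by rewrite !preimage_setU !rK [_ `|` N0]setUC.
rewrite E1 /D1 /N1 EB /Ta -ra.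
apply/funext => lam; apply/eqP; rewrite eq_le; apply/andP; split.
  exact: transplant_sigma_le.
(* The reverse inequality is the same statement with the two lines exchanged. *)
by apply: transplant_sigma_le => // p bp ap; apply: nba bp ap; exact: nab'.
Qed.
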